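(* Let $P$ be a $d$-polytope with $f_0(P)\ge 2d+1$ vertices and $f_{d-1}(P)=d+2$ facets. Then for all $1\le m\le d-1$, $$f_m(P)\ \ge\ \binom{d+1}{m+1}+\binom{d}{m+1}+\binom{d-1}{m+1}-\binom{\lceil d/2\rceil}{m+1}-\binom{\lceil d/2\rceil-1}{m+1}.$$ Moreover, when $f_0(P)=2d+1$ and $d\ge 4$ is even, this lower bound is sharp: it is attained for every $m\ge 1$ by $P=\big(T^{d,\frac d2-2}_2\big)^*$.
   Context: A $d$-polytope is a $d$-dimensional convex polytope; $f_m(P)$ is the number of its $m$-dimensional faces, facets are its $(d-1)$-faces, and $P^*$ denotes the dual polytope. For $1\le m\le\lfloor i/2\rfloor$, $T^i_m$ denotes the (combinatorial type of the) simplicial $i$-polytope with $i+2$ vertices that is the convex hull of an $i$-simplex together with one additional point lying beyond exactly $m$ facets of the simplex (and strictly beneath the remaining facets). For $2\le i\le d$ and $1\le m\le \lfloor i/2\rfloor$, $T^{d,d-i}_m$ denotes the $d$-polytope that is the $(d-i)$-fold pyramid over $T^i_m$. Thus $T^{d,\frac d2-2}_2$ is the $(\frac d2-2)$-fold pyramid over $T^{\frac d2+2}_2$. The convention $\binom{n}{j}=0$ for $0\le n<j$ is used. *)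

(* Defs.v *)
From mathcomp Require Import all_boot all_order all_algebra.
From mathcomp Require Import finmap.
From mathcomp Require Import boolp classical_sets functions cardinality reals.

Set Implicit Arguments.
Unset Strict Implicit.
Unset Printing Implicit Defensive.

Import Order.TTheory GRing.Theory Num.Theory.

Local Open Scope classical_set_scope.
Local Open Scope ring_scope.

Section Polytopes.
Variables (R : realType) (n : nat).
Implicit Types (A P Q S F : set 'rV[R]_n) (x : 'rV[R]_n).

Definition convex_hull A : set 'rV[R]_n :=
  [set y | exists k (w : 'I_k -> R) (p : 'I_k -> 'rV[R]_n),
     [/\ forall i, A (p i), forall i, 0 <= w i, \sum_i w i = 1
       & y = \sum_i w i *: p i]].

Definition affine_hull A : set 'rV[R]_n :=
  [set y | exists k (w : 'I_k -> R) (p : 'I_k -> 'rV[R]_n),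
     [/\ forall i, A (p i), \sum_i w i = 1 & y = \sum_i w i *: p i]].

(* The affine hull of A is a translate of a d-dimensional linear subspace; in
   particular the empty set has no dimension in nat. *)
Definition has_dim A (d : nat) : Prop :=
  exists x (U : {vspace 'rV[R]_n}),
    [/\ A x, \dim U = d & affine_hull A = [set y | y - x \in U]].

Definition is_polytope P : Prop :=
  exists2 V : set 'rV[R]_n, finite_set V & P = convex_hull V.

(* The ambient dimension n may exceed d. *)
Definition is_dpolytope (d : nat) P : Prop := is_polytope P /\ has_dim P d.

Definition linval (a : 'cV[R]_n) x : R := (x *m a) 0 0.

(* The functional a may be zero, so that P itself and the empty set are faces. *)
Definition is_face P F : Prop :=
  exists (a : 'cV[R]_n) (b : R),
    (forall x, P x -> linval a x <= b) /\
    F = P `&` [set x | linval a x = b].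

(* fset_set sends infinite sets to fset0, but a polytope has only finitely many
   faces. *)
Definition fnum (m : nat) P : nat :=
  #|` fset_set [set F | is_face P F /\ has_dim F m] |%fset.

(* For a proper face F of P and x in the affine hull of P. *)
Definition beyond P F x : Prop :=
  exists (a : 'cV[R]_n) (b : R),
    [/\ forall y, P y -> linval a y <= b,
        F = P `&` [set y | linval a y = b] & b < linval a x].

Definition beneath P F x : Prop :=
  exists (a : 'cV[R]_n) (b : R),
    [/\ forall y, P y -> linval a y <= b,
        F = P `&` [set y | linval a y = b] & linval a x < b].

Definition affinely_independent k (v : 'I_k -> 'rV[R]_n) : Prop :=
  forall w : 'I_k -> R,
    \sum_i w i = 0 -> \sum_i w i *: v i = 0 -> forall i, w i = 0.

Definition is_simplex (i : nat) S : Prop :=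
  exists2 v : 'I_i.+1 -> 'rV[R]_n,
    affinely_independent v & S = convex_hull (range v).

Definition facets (d : nat) P : set (set 'rV[R]_n) :=
  [set F | is_face P F /\ has_dim F d.-1].

(* The realizations of T^i_m. *)
Definition is_T (i m : nat) P : Prop :=
  (1 <= m <= i./2)%N /\
  exists S x,
    [/\ is_simplex i S, affine_hull S x,
        ([set F | facets i S F /\ beyond S F x] #= `I_m)%card,
        forall F, facets i S F -> ~ beyond S F x -> beneath S F x
      & P = convex_hull (S `|` [set x])].

Definition is_pyramid Q P : Prop :=
  exists2 x, ~ affine_hull Q x & P = convex_hull (Q `|` [set x]).

Fixpoint is_iter_pyramid (r : nat) Q P : Prop :=
  if r is r'.+1 then exists2 P', is_iter_pyramid r' Q P' & is_pyramid P' P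
  else P = Q.

(* The realizations of T^{d,r}_m, the r-fold pyramid over T^{d-r}_m. *)
Definition is_Tpyr (d r m : nat) P : Prop :=
  exists2 T, is_T (d - r) m T & is_iter_pyramid r T P.

End Polytopes.

Definition are_dual (R : realType) (n n' : nat)
    (P : set 'rV[R]_n) (Q : set 'rV[R]_n') : Prop :=
  exists phi : set 'rV[R]_n -> set 'rV[R]_n',
    set_bij [set F | is_face P F] [set G | is_face Q G] phi /\
    forall F F', is_face P F -> is_face P F' ->
      (F `<=` F' <-> phi F' `<=` phi F).

(* The convention 'C(k, j) = 0 for k < j is that of binomial. *)
Definition lower_bound (d m : nat) : int :=
  'C(d.+1, m.+1)%:Z + 'C(d, m.+1)%:Z + 'C(d.-1, m.+1)%:Z
  - 'C(uphalf d, m.+1)%:Z - 'C((uphalf d).-1, m.+1)%:Z.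

(* Main.v *)
(* A d-polytope P with d+2 facets is determined by its d+2 slack functions; their
   values on the cone over P fill a hyperplane section of the positive orthant of
   R^(d+2), so the nonempty faces of P correspond to the supports of the nonzero
   nonnegative solutions of a single linear equation.  If the equation has p
   positive, q negative and r zero coefficients, a set J is such a support iff it
   meets the positive indices exactly when it meets the negative ones, and the
   face lattice forces the face of J to have dimension |J| - 2 or |J| - 1.
   Counting gives
     f_m = C(d+2,m+2) - C(q+r,m+2) - C(p+r,m+2) + C(r+1,m+2)
         = C(d+1,m+1) + sum of C(d-1-i-j,m) over i < p-1, j < q-1.
   Now f_0 = pq + r >= 2d+1 says (p-1)(q-1) >= d, and among such rectangles the
   strip 2 x floor(d/2), which gives the bound, minimizes the sum.
   The vertices of T^{d,r}_m have a one-dimensional space of affine dependencies,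
   and the same lattice, reversed, describes the faces of their hull; hence its
   dual has the face numbers above with p = 3, q = d/2 + 1, r = d/2 - 2. *)
Require Import Defs.
From mathcomp Require Import all_boot all_order all_algebra.
From mathcomp Require Import finmap.
From mathcomp Require Import boolp classical_sets functions cardinality reals.
From mathcomp Require Import zify ring lra.

Set Implicit Arguments.
Unset Strict Implicit.
Unset Printing Implicit Defensive.

Import Order.TTheory GRing.Theory Num.Theory.

Local Open Scope ring_scope.

(** * Supports of solutions of one linear equation *)

(** Both halves reduce to the one count [fnum_balanced], because the poset of balanced sets fixes
    the dimensions as well: in a d-polytope whose face lattice is this poset, rank and dimension
    must agree ([face_rank_iso]). In the first half the poset comes from the facet slacks of P. In
    the second it comes from the generators of the dual, at which the affine functionals take as
    values exactly the solutions of the dependency; no geometry of P beyond its dimension is then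
    used. Eliminating r = d + 2 - p - q turns p q + r >= 2 d + 1 into (p - 1)(q - 1) >= d. For even
    d, p = 3 and q = d/2 + 1 make the rectangle equal to the extremal strip. In T^{d/2+2}_2 the
    added point has two negative and d/2 + 1 positive barycentric coordinates and itself enters the
    dependency with coefficient -1, hence 3 and d/2 + 1; each of the d/2 - 2 apexes contributes a
    coefficient zero. That a dual of T^{d,d/2-2}_2 exists is shown by cutting the solution cone of
    its dependency with the hyperplane of coordinate sum 1. *)

Section Balanced.
Variables (I : finType) (A B : {set I}).
Implicit Types J : {set I}.

(* Those J meeting A exactly when they meet B are the supports of the
   nonnegative solutions of one linear equation with positive coefficients on A
   and negative ones on B. *)
Definition balanced J := [disjoint J & A] == [disjoint J & B].

(** For balanced [J], the dimension of the cone of nonnegative solutions supported in [J]: the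
    equation costs one dimension unless [J] avoids [A] and [B], where it reads 0 = 0. The
    corresponding face has dimension one less. *)
Definition balrank J : nat := #|J| - ~~ [disjoint J & A].

Lemma disjoint_sub0 J (X : {set I}) i : i \in J -> i \in X -> [disjoint J & X] = false.
Proof.
by move=> iJ iX; apply/negbTE/pred0Pn; exists i; rewrite /= iJ iX.
Qed.

Lemma meetsP J (X : {set I}) : reflect (exists2 i, i \in J & i \in X) (~~ [disjoint J & X]).
Proof.
by apply: (iffP pred0Pn) => [[i /andP[iJ iX]]|[i iJ iX]]; exists i => //; apply/andP.
Qed.

Arguments meetsP {J X}.

Hypothesis AB : [disjoint A & B].

(** If one point of [A] and one of [B] stay, any third point can go. From a pair [[set a; b]] both
    go at once, which lowers the rank only from 1 to 0. *)
Lemma balanced_pred J : balanced J -> (0 < balrank J)%N ->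
  exists2 J', balanced J' & (J' \proper J) && (balrank J == (balrank J').+1).
Proof.
have rm J0 x : x \in J0 -> (J0 :\ x \proper J0) && (#|J0| == #|J0 :\ x|.+1).
  by move=> xJ; rewrite properD1//= (cardsD1 x J0) xJ.
have dis x (X : {set I}) : x \in J -> x \notin X -> [disjoint J :\ x & X] = [disjoint J & X].
  move=> xJ xX; apply/idP/idP => [dx|]; last by apply/disjointWl/subD1set.
  apply: contraTT dx => /meetsP[i iJ iX]; apply/meetsP; exists i => //.
  by rewrite !inE iJ andbT; apply: contraNneq xX => <-.
move=> bJ r0; case: (boolP [disjoint J & A]) => dA.
  have dB : [disjoint J & B] by rewrite -(eqP bJ).
  move: r0; rewrite /balrank dA subn0 => /card_gt0P[x xJ].
  have dis' (X : {set I}) : [disjoint J & X] -> [disjoint J :\ x & X].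
    by apply: disjointWl; exact: subD1set.
  exists (J :\ x); first by rewrite /balanced !dis'.
  by rewrite dis'// subn0 rm.
have mB : ~~ [disjoint J & B] by rewrite -(eqP bJ).
have /meetsP[a aJ aA] := dA; have /meetsP[b bJ' bB] := mB.
have aB : a \notin B by rewrite (disjointFr AB aA).
have bA : b \notin A by rewrite (disjointFl AB bB).
have ab : a != b by apply: contraNneq aB => ->.
have card2 x : x \in J -> (0 < #|J :\ x|)%N.
  move=> xJ; apply/card_gt0P; have [xa|xa] := eqVneq x a.
    by exists b; rewrite !inE bJ' xa eq_sym ab.
  by exists a; rewrite !inE aJ eq_sym xa.
case: (boolP [exists x in J, (x != a) && (x != b)]) => [/exists_inP[x xJ /andP[xa xb]]|nx].
  have mA' : [disjoint J :\ x & A] = false.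
    by apply: (disjoint_sub0 (i := a)); rewrite // !inE aJ eq_sym xa.
  have mB' : [disjoint J :\ x & B] = false.
    by apply: (disjoint_sub0 (i := b)); rewrite // !inE bJ' eq_sym xb.
  exists (J :\ x); first by rewrite /balanced mA' mB'.
  have /andP[-> /eqP e] := rm J x xJ.
  by rewrite /balrank mA' dA/= e !subn1/= prednK// card2.
have JE : J = [set a; b]%SET.
  apply/setP => x; rewrite !inE; apply/idP/idP => [xJ|/orP[] /eqP ->//].
  by apply: contraNT nx => xab; apply/exists_inP; exists x => //; rewrite -negb_or.
exists finset.set0; first by rewrite /balanced !eq_disjoint0// => i; rewrite inE.
have d0 (X : {set I}) : [disjoint finset.set0 & X].
  by rewrite eq_disjoint0// => i; rewrite inE.
rewrite /balrank dA d0 cards0 JE cards2 ab /= andbT finset.properEneq finset.sub0set andbT.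
by apply/eqP => /setP/(_ a); rewrite !inE eqxx.
Qed.

(** One point can be added unless [J] avoids [A] and [B] and contains everything else; then [a] and
    [b] enter together, and the rank still grows by one. *)
Lemma balanced_succ d a b : #|I| = (d + 2)%N -> a \in A -> b \in B ->
  forall J, balanced J -> (balrank J <= d)%N ->
  exists2 J', balanced J' & (J \proper J') && (balrank J' == (balrank J).+1).
Proof.
move=> cI aA bB J bJ rd.
have ad x : x \notin J -> (J \proper x |: J) && (#|x |: J| == #|J|.+1).
  move=> xJ; rewrite cardsU1 xJ eqxx andbT properE finset.subsetUr/=.
  by apply/subsetPn; exists x; rewrite // !inE eqxx.
have [dA|mA] := boolP [disjoint J & A].
  have dB : [disjoint J & B] by rewrite -(eqP bJ).
  have aJ : a \notin J by apply: contraTN dA => aJ; rewrite (disjoint_sub0 aJ).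
  have bJ' : b \notin J by apply: contraTN dB => bJ'; rewrite (disjoint_sub0 bJ').
  have aB : a \notin B by rewrite (disjointFr AB aA).
  have ab : a != b by apply: contraNneq aB => ->.
  case: (boolP [exists x, [&& x \notin J, x \notin A & x \notin B]]).
    move=> /existsP[x /and3P[xJ xA xB]].
    have dX (X : {set I}) : x \notin X -> [disjoint J & X] -> [disjoint x |: J & X].
      move=> xX dX; apply: contraT => /meetsP[i]; rewrite !inE => /orP[/eqP ->|iJ] iX.
        by rewrite iX in xX.
      by rewrite (disjoint_sub0 iJ) in dX.
    exists (x |: J); first by rewrite /balanced !dX.
    by rewrite /balrank !dX// dA !subn0 ad.
  rewrite negb_exists => /forallP nx.
  have mA' : [disjoint a |: (b |: J) & A] = false.
    by apply: (disjoint_sub0 (i := a)); rewrite // !inE eqxx.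
  have mB' : [disjoint a |: (b |: J) & B] = false.
    by apply: (disjoint_sub0 (i := b)); rewrite // !inE eqxx orbT.
  exists (a |: (b |: J)); first by rewrite /balanced mA' mB'.
  rewrite /balrank mA' dA subn0 !cardsU1 !inE (negbTE ab) (negbTE aJ) bJ' /= subn1.
  rewrite add1n /= add1n eqxx andbT; apply: proper_trans (_ : b |: J \proper _).
    by have /andP[] := ad b bJ'.
  rewrite properE finset.subsetUr/=; apply/subsetPn; exists a; first by rewrite !inE eqxx.
  by rewrite !inE negb_or ab.
have mB : ~~ [disjoint J & B] by rewrite -(eqP bJ).
have [x xJ] : exists x, x \notin J.
  apply/existsP; rewrite -negb_forall; apply: contraTN rd => /forallP h.
  have -> : J = [set: I]%SET by apply/setP => x; rewrite h inE.
  rewrite /balrank cardsT cI -ltnNge; case: disjoint => /=; lia.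
have mX (X : {set I}) : ~~ [disjoint J & X] -> [disjoint x |: J & X] = false.
  by move=> /meetsP[i iJ iX]; apply: (disjoint_sub0 (i := i)); rewrite // !inE iJ orbT.
exists (x |: J); first by rewrite /balanced !mX.
have /andP[-> /eqP e] := ad x xJ.
rewrite /balrank mX// mA /= e !subn1 /=.
have /meetsP[y yJ _] := mA.
by rewrite prednK//; apply/card_gt0P; exists y.
Qed.

Lemma card_disjoint_draws (X : {set I}) k :
  #|[set J : {set I} | [disjoint J & X] & #|J| == k]%SET| = 'C(#|~: X|, k).
Proof.
rewrite -cards_draws; apply: eq_card => J; rewrite !inE.
by rewrite finset.disjoints_subset.
Qed.

(** Such a set either avoids [A] and [B] and has m + 1 points, or meets both and has m + 2;
    inclusion-exclusion counts the latter. Negative terms stand on the other side to stay within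
    nat. *)
Lemma card_balanced m :
  (#|[set J | balanced J & balrank J == m.+1]%SET|
    + 'C(#|~: A|, m.+2) + 'C(#|~: B|, m.+2) =
  'C(#|I|, m.+2) + 'C(#|~: (A :|: B)|, m.+2) + 'C(#|~: (A :|: B)|, m.+1))%N.
Proof.
pose S (X : {set I}) k := [set J : {set I} | [disjoint J & X] & #|J| == k]%SET.
pose M := [set J : {set I} | [&& ~~ [disjoint J & A], ~~ [disjoint J & B] & #|J| == m.+2]]%SET.
have dU J : [disjoint J & A :|: B] = [disjoint J & A] && [disjoint J & B].
  by rewrite !finset.disjoints_subset finset.setCU finset.subsetI.
have -> : [set J | balanced J & balrank J == m.+1]%SET = M :|: S (A :|: B) m.+1.
  apply/setP => J; rewrite !inE dU /balanced /balrank.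
  case: (boolP [disjoint J & A]) => [dA|/meetsP[y yJ _]]; case: (boolP [disjoint J & B]) => //=;
    rewrite ?subn0 ?andbF ?orbF//.
  by move=> _; rewrite subn1 -eqSS prednK//; apply/card_gt0P; exists y.
rewrite cardsU; have -> : M :&: S (A :|: B) m.+1 = finset.set0.
  by apply/setP => J; rewrite !inE dU; case: [disjoint J & A]; rewrite /= ?andbF.
have cI : #|[set J : {set I} | #|J| == m.+2]%SET| = (#|M| + #|S A m.+2 :|: S B m.+2|)%N.
  rewrite -cardsUI; have -> : M :&: (S A m.+2 :|: S B m.+2) = finset.set0.
    by apply/setP => J; rewrite !inE; case: [disjoint J & A]; case: [disjoint J & B]; rewrite /= ?andbF.
  rewrite cards0 addn0; congr #|pred_of_set _|; apply/setP => J; rewrite !inE.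
  by case: [disjoint J & A]; case: [disjoint J & B]; rewrite /= ?orbF ?orbb.
have SI : S A m.+2 :&: S B m.+2 = S (A :|: B) m.+2.
  by apply/setP => J; rewrite !inE dU; case: [disjoint J & A]; case: [disjoint J & B]; rewrite /= ?andbF ?andbb.
move: cI; rewrite card_draws cardsU SI cards0 -!card_disjoint_draws -/(S _ _) -/(S _ _).
have := cardsUI (S A m.+2) (S B m.+2); rewrite SI -!/(S _ _).
have : (#|S (A :|: B) m.+2| <= #|S A m.+2|)%N.
  by apply/subset_leq_card/fintype.subsetP => J; rewrite !inE dU => /andP[/andP[-> _] ->].
rewrite /S; lia.
Qed.

End Balanced.

Section Supports.
Variables (R : realDomainType) (I : finType) (w : I -> R).

Definition supp (s : I -> R) : {set I} := [set i | s i != 0]%SET.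

Lemma balanced_supp (J : {set I}) :
  balanced [set i | 0 < w i]%SET [set i | w i < 0]%SET J <->
  exists s : I -> R, [/\ forall i, 0 <= s i, \sum_i w i * s i = 0 & supp s = J].
Proof.
set A := finset _; set B := finset _; split=> [bJ|[s [s0 ws <-]]].
  have [dA|mA] := boolP [disjoint J & A].
    have dB : [disjoint J & B] by rewrite -(eqP bJ).
    exists (fun i => (i \in J)%:R); split.
    - by move=> i; rewrite ler0n.
    - apply: big1 => i _; case: (boolP (i \in J)) => [iJ|]; rewrite ?mulr0//.
      have := disjointFr dA iJ; have := disjointFr dB iJ.
      by rewrite !inE mulr1; case: ltgtP.
    - by apply/setP => i; rewrite inE pnatr_eq0 eqb0 negbK.
  have mB : ~~ [disjoint J & B] by rewrite -(eqP bJ).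
  pose M := \sum_(i in J :&: A) w i; pose N := \sum_(i in J :&: B) - w i.
  have M0 : 0 < M.
    have /meetsP[a aJ aA] := mA.
    rewrite /M (bigD1 a) ?finset.in_setI ?aJ ?aA//=.
    move: aA; rewrite inE => /ltr_pwDl; apply; apply: sumr_ge0 => i.
    by rewrite !inE => /andP[/andP[_ /ltW]].
  have N0 : 0 < N.
    have /meetsP[a aJ aA] := mB.
    rewrite /N (bigD1 a) ?finset.in_setI ?aJ ?aA//=.
    move: aA; rewrite inE -oppr_gt0 => /ltr_pwDl; apply; apply: sumr_ge0 => i.
    by rewrite !inE -oppr_gt0 => /andP[/andP[_ /ltW]].
  (* Positive indices get the total negative weight and conversely, so the two parts of the equation
     become M * N and - (N * M). *)
  pose s i := if i \in J then if 0 < w i then N else if w i < 0 then M else 1 else 0.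
  exists s; split.
  - by move=> i; rewrite /s; case: ifP => // _; case: ifP => _; [|case: ifP => _]; rewrite ?ltW.
  - have E i : w i * s i = (if i \in J :&: A then w i * N else 0)
        + (if i \in J :&: B then w i * M else 0).
      rewrite /s !inE; case: (i \in J) => /=; last by rewrite mulr0 addr0.
      case: (ltgtP (w i) 0) => wi; rewrite ?addr0 ?add0r//.
      by rewrite -wi; ring.
    under eq_bigr do rewrite E.
    rewrite big_split/= -!big_mkcond/= -!mulr_suml -/M.
    by rewrite -[X in X * M]opprK -sumrN -/N; ring.
  - apply/setP => i; rewrite inE /s; case: (i \in J); rewrite ?eqxx//.
    by case: ifP => _; [|case: ifP => _]; rewrite ?oner_eq0// gt_eqF.
(* Used for [w] and for [- w]: a positive term of a vanishing sum needs a term of the opposite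
   sign. *)
have key (v : I -> R) (X : {set I}) : (forall i, s i != 0 -> i \notin X -> 0 <= v i) ->
    \sum_i v i * s i = 0 -> forall a, s a != 0 -> ~~ (0 < v a) || ~~ [disjoint supp s & X].
  move=> v0 vs a sa; rewrite -negb_and; apply/negP => /andP[va dX].
  have h i : 0 <= v i * s i.
    have [->|si] := eqVneq (s i) 0; first by rewrite mulr0.
    by rewrite mulr_ge0// v0//; rewrite (disjointFr dX)// inE.
  move/eqP: vs; rewrite psumr_eq0// => /allP/(_ a); rewrite mem_index_enum => /(_ isT)/=.
  by rewrite mulf_eq0 (negbTE sa) (gt_eqF va).
rewrite /balanced; apply/eqP; apply/idP/idP; apply: contraTT => /meetsP[a].
  rewrite inE => sa; rewrite inE -oppr_gt0 => wa.
  have := key (fun i => - w i) A _ _ a sa; rewrite wa/=; apply.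
    by move=> i _; rewrite inE -leNgt oppr_ge0.
  by under eq_bigr do rewrite mulNr; rewrite sumrN ws oppr0.
rewrite inE => sa; rewrite inE => wa.
have := key w B _ ws a sa; rewrite wa/=; apply.
by move=> i _; rewrite inE -leNgt.
Qed.

End Supports.

(** * Binomial sums over rectangles *)

Section Arithmetic.
Local Open Scope nat_scope.

Lemma binS_sum n k m : 'C(n + k, m.+1) = 'C(n, m.+1) + \sum_(j < k) 'C(n + j, m).
Proof.
elim: k => [|k IHk]; first by rewrite addn0 big_ord0 addn0.
by rewrite addnS binS IHk big_ord_recr/= addnA.
Qed.

(** Summation over [j] and then over [i] telescopes by the hockey-stick identity: the rectangle sum
    is a mixed second difference of ['C(_, m.+2)]. *)
Lemma bin_rect r a b m :
  \sum_(i < a) \sum_(j < b) 'C(r + i + j, m) + 'C(r + b, m.+2) + 'C(r + a, m.+2) =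
  'C(r + a + b, m.+2) + 'C(r, m.+2).
Proof.
have E i : \sum_(j < b) 'C(r + i + j, m) + 'C(r + i, m.+1) = 'C(r + b + i, m.+1).
  by rewrite addnC -binS_sum addnAC.
have : \sum_(i < a) (\sum_(j < b) 'C(r + i + j, m) + 'C(r + i, m.+1)) =
    \sum_(i < a) 'C(r + b + i, m.+1) by apply: eq_bigr.
rewrite big_split/= [r + a + b]addnAC (binS_sum (r + b) a) (binS_sum r a) => <-.
by rewrite -!addnA addnCA; congr (_ + (_ + _)); rewrite addnC.
Qed.

(** A half turn of the rectangle: the count yields binomials that grow away from the corner, whereas
    [rect_ge_strip] wants them decreasing. *)
Lemma sum_rev_rect (g : nat -> nat) a b s : a + b <= s.+1 ->
  \sum_(i < a) \sum_(j < b) g (s.+1 - a - b + i + j) =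
  \sum_(i < a) \sum_(j < b) g (s.-1 - i - j).
Proof.
move=> abs; rewrite (reindex_inj rev_ord_inj)/=; apply: eq_bigr => i _.
rewrite (reindex_inj rev_ord_inj)/=; apply: eq_bigr => j _; congr g.
by have := ltn_ord i; have := ltn_ord j; lia.
Qed.

(* Two full rows and, below them, two full columns of the a x b rectangle carry
   the same values as the first a + b - 2 columns of a strip of width two. *)
Lemma rect_ge_strip (g : nat -> nat) a b h :
  (forall i j, i <= j -> g j <= g i) -> 2 <= a -> 2 <= b -> 2 * h <= a * b ->
  \sum_(i < 2) \sum_(j < h) g (i + j) <= \sum_(i < a) \sum_(j < b) g (i + j).
Proof.
move=> gd; case: a => [|[|a]]// _; case: b => [|[|b]]// _ hab.
pose t j := g j + g j.+1.
have two k : \sum_(i < 2) \sum_(j < k) g (i + j) = \sum_(j < k) t j.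
  by rewrite big_ord_recl big_ord1 -big_split.
rewrite two -[a.+2]/(2 + a) big_split_ord/= two.
have -> : \sum_(i < a) \sum_(j < b.+2) g (2 + i + j) =
    \sum_(i < a) \sum_(j < b) g (2 + i + j) + \sum_(i < a) t (b.+2 + i).
  rewrite -big_split/=; apply: eq_bigr => i _.
  rewrite !big_ord_recr/= -addnA /t; congr (_ + (g _ + g _)); lia.
have cat k l : \sum_(j < k + l) t j = \sum_(j < k) t j + \sum_(j < l) t (k + j).
  by rewrite big_split_ord.
rewrite addnCA -cat.
have mid : a * b * g (a + b) <= \sum_(i < a) \sum_(j < b) g (2 + i + j).
  rewrite -{1}[a]card_ord -{1}[b]card_ord -mulnA -!sum_nat_const.
  apply: leq_sum => i _; apply: leq_sum => j _; apply: gd.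
  by have := ltn_ord i; have := ltn_ord j; lia.
have [hs|sh] := leqP h (b.+2 + a).
  apply: leq_trans (leq_addl _ _); rewrite -(subnKC hs) cat; exact: leq_addr.
(* With [a] and [b] now reduced by 2, the area hypothesis leaves at most a * b further cells in the
   strip, each at most [g (a + b)], and every cell of the a x b inner block is at least that. *)
rewrite -(subnKC (ltnW sh)) (cat (b.+2 + a)) [leqLHS]addnC leq_add2r; apply: leq_trans mid.
apply: (@leq_trans (\sum_(i < h - (b.+2 + a)) 2 * g (a + b))).
  apply: leq_sum => i _; rewrite /t mul2n -addnn; apply: leq_add; apply: gd; lia.
rewrite sum_nat_const card_ord mulnA leq_mul2r; apply/orP; right; nia.
Qed.

(** This is the vertex count: for m = 0 each cell of the (p - 1) x (q - 1) rectangle weighs 1. *)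
Lemma rect_count_vertices p q r f : 0 < p -> 0 < q ->
  f + 'C(q + r, 2) + 'C(p + r, 2) = 'C(p + q + r, 2) + 'C(r.+1, 2) -> f = p * q + r.
Proof.
case: p => // a _; case: q => // b _.
have := bin_rect r.+1 a b 0.
under eq_bigr do under eq_bigr do rewrite bin0.
rewrite !sum_nat_const !card_ord muln1.
have -> : a.+1 + b.+1 + r = (r.+1 + a + b).+1 by lia.
have -> : b.+1 + r = r.+1 + b by lia.
have -> : a.+1 + r = r.+1 + a by lia.
rewrite (binS (r.+1 + a + b)) bin1; nia.
Qed.

(** Each row of the strip telescopes by [binS_sum], one from [uphalf d] up to d, the other from
    [(uphalf d).-1] up to d - 1. *)
Lemma lower_boundE d m : 2 <= d ->
  lower_bound d m = ('C(d.+1, m.+1)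
    + \sum_(i < 2) \sum_(j < d./2) 'C(d.-1 - i - j, m))%N :> int.
Proof.
move=> d2; rewrite /lower_bound.
have dE := odd_double_half d.
have hd : d./2 + 2 <= d.+1 by lia.
rewrite -(sum_rev_rect (fun k => 'C(k, m)) (a := 2) (b := d./2)); last lia.
rewrite big_ord_recl big_ord1 /= /bump /=.
have ud : uphalf d = (d - d./2)%N by rewrite uphalf_half; lia.
have -> : d.+1 - 2 - d./2 + 0 = (d - d./2).-1 by lia.
have -> : d.+1 - 2 - d./2 + (1 + 0) = d - d./2 by lia.
have e1 := binS_sum (d - d./2) d./2 m.
have e2 := binS_sum (d - d./2).-1 d./2 m.
have d1 : d - d./2 + d./2 = d by lia.
have d2' : (d - d./2).-1 + d./2 = d.-1 by lia.
rewrite d1 in e1; rewrite d2' in e2.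
rewrite ud e1 e2.
move: (\sum_(_ < _) _) (\sum_(_ < _) _) => s1 s2; rewrite !PoszD; ring.
Qed.

Lemma rect_face_count p q r d m f : 0 < p -> 0 < q -> (p + q + r = d + 2)%N ->
  f + 'C(q + r, m.+2) + 'C(p + r, m.+2) = 'C(p + q + r, m.+2) + 'C(r.+1, m.+2) ->
  f = 'C(d.+1, m.+1) + \sum_(i < p.-1) \sum_(j < q.-1) 'C(d.-1 - i - j, m).
Proof.
case: p => // a _; case: q => // b _ e.
rewrite -(sum_rev_rect (fun k => 'C(k, m))) /=; last lia.
have -> : d.+1 - a - b = r.+1 by lia.
have := bin_rect r.+1 a b m.
have -> : a.+1 + b.+1 + r = (r.+1 + a + b).+1 by lia.
have -> : b.+1 + r = r.+1 + b by lia.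
have -> : a.+1 + r = r.+1 + a by lia.
have -> : d.+1 = r.+1 + a + b by lia.
rewrite (binS (r.+1 + a + b)); move: (\sum_(_ < _) _) => s; lia.
Qed.

Lemma lower_bound_le p q r d m f0 f : 0 < p -> 0 < q -> 2 <= d ->
  (p + q + r = d + 2)%N ->
  f0 + 'C(q + r, 2) + 'C(p + r, 2) = 'C(p + q + r, 2) + 'C(r.+1, 2) ->
  2 * d + 1 <= f0 ->
  f + 'C(q + r, m.+2) + 'C(p + r, m.+2) = 'C(p + q + r, m.+2) + 'C(r.+1, m.+2) ->
  (lower_bound d m <= f%:Z)%R.
Proof.
move=> p0 q0 d2 e /(rect_count_vertices p0 q0) -> f0d /(rect_face_count p0 q0 e) ->.
rewrite lower_boundE// lez_nat leq_add2l.
under eq_bigr do under eq_bigr do rewrite -subnDA.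
under [leqRHS]eq_bigr do under eq_bigr do rewrite -subnDA.
(* This is [2 * d + 1 <= p * q + r] with [r] eliminated. *)
have pq : d <= p.-1 * q.-1 by case: p p0 e f0d => // p _; case: q q0 => // q _ /=; nia.
apply: (@rect_ge_strip (fun k => 'C(d.-1 - k, m))).
- by move=> i j ij; apply: leq_bin2l; lia.
- by case: p p0 e f0d pq => // -[|[|p]] //= _; case: q q0 => // q _ /=; nia.
- by case: q q0 e f0d pq => // -[|[|q]] //= _; case: p p0 => // p _ /=; nia.
- by apply: leq_trans pq; have := odd_double_half d; lia.
Qed.

Lemma lower_bound_eq d m f : 4 <= d -> ~~ odd d ->
  f + 'C(d./2.+1 + (d./2 - 2), m.+2) + 'C(3 + (d./2 - 2), m.+2) =
    'C(3 + d./2.+1 + (d./2 - 2), m.+2) + 'C((d./2 - 2).+1, m.+2) ->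
  f%:Z = lower_bound d m.
Proof.
move=> d4 de /(@rect_face_count 3 d./2.+1 (d./2 - 2) d m f isT isT) ->; last first.
  by have := odd_double_half d; lia.
by rewrite lower_boundE//; lia.
Qed.

End Arithmetic.

Local Open Scope classical_set_scope.
Local Open Scope ring_scope.

(** * Hulls, affine functionals and dimension *)

Section Hulls.
Variables (R : realType) (n : nat).
Implicit Types (P F : set 'rV[R]_n) (x y : 'rV[R]_n) (c : 'cV[R]_(n + 1)).

Lemma range_regroup (I : finType) (V : lmodType R) (u : I -> V) k
    (w : 'I_k -> R) (p : 'I_k -> V) :
  (forall i, range u (p i)) ->
  exists f : 'I_k -> I,
    \sum_i w i *: p i = \sum_j (\sum_(i | f i == j) w i) *: u j /\
    \sum_i w i = \sum_j \sum_(i | f i == j) w i.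
Proof.
move=> pu; have /choice[f fE] : forall i, exists j, u j = p i.
  by move=> i; have [j _ <-] := pu i; exists j.
exists f; split.
  rewrite (partition_big f predT)//=; apply: eq_bigr => j _.
  by rewrite scaler_suml; apply: eq_bigr => i /eqP <-; rewrite fE.
by rewrite (partition_big f predT).
Qed.

Lemma sum_enum_val (I : finType) (V : nmodType) (f : I -> V) :
  \sum_(i < #|I|) f (enum_val i) = \sum_i f i.
Proof.
by rewrite (reindex (@enum_val I predT))//=; apply: onW_bij; apply: enum_val_bij.
Qed.

Lemma convex_hull_range (I : finType) (u : I -> 'rV[R]_n) y :
  convex_hull (range u) y <->
  exists w : I -> R,
    [/\ forall i, 0 <= w i, \sum_i w i = 1 & y = \sum_i w i *: u i].
Proof.
split=> [[k [w [p [pu w0 w1 ->]]]]|[w [w0 w1 ->]]].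
  have [f [-> e]] := range_regroup w pu.
  exists (fun j => \sum_(i | f i == j) w i); split => //.
  - by move=> j; apply: sumr_ge0.
  - by rewrite -e.
exists #|I|, (w \o enum_val), (u \o enum_val); split => //=.
- by move=> i; exists (enum_val i).
- by rewrite -w1 sum_enum_val.
- by rewrite (sum_enum_val (fun i => w i *: u i)).
Qed.

Lemma affine_hull_range (I : finType) (u : I -> 'rV[R]_n) y :
  affine_hull (range u) y <->
  exists w : I -> R, \sum_i w i = 1 /\ y = \sum_i w i *: u i.
Proof.
split=> [[k [w [p [pu w1 ->]]]]|[w [w1 ->]]].
  have [f [-> e]] := range_regroup w pu.
  by exists (fun j => \sum_(i | f i == j) w i); split => //; rewrite -e.
exists #|I|, (w \o enum_val), (u \o enum_val); split => //=.
- by move=> i; exists (enum_val i).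
- by rewrite -w1 sum_enum_val.
- exact/esym/(sum_enum_val (fun i => w i *: u i)).
Qed.

Lemma sub_convex_hull P : P `<=` convex_hull P.
Proof.
move=> x Px; exists 1%N, (fun=> 1), (fun=> x); split => //.
- by rewrite big_ord1.
- by rewrite big_ord1 scale1r.
Qed.

Lemma convex_sub_affine P : convex_hull P `<=` affine_hull P.
Proof. by move=> y [k [w [p [pP _ w1 ->]]]]; exists k, w, p. Qed.

Lemma sub_affine_hull P : P `<=` affine_hull P.
Proof. by move=> x /sub_convex_hull /convex_sub_affine. Qed.

Lemma affine_hullS P F : P `<=` F -> affine_hull P `<=` affine_hull F.
Proof. by move=> PF y [k [w [p [pP w1 ->]]]]; exists k, w, p; split=> // i; apply: PF. Qed.

(** In homogeneous coordinates an affine functional becomes linear, a column of height n + 1, so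
    that matrix ranks and kernels apply. *)
Definition ev c x : R := (row_mx x 1%:M *m c) 0 0.

Lemma evE c x : ev c x = linval (usubmx c) x + c (rshift n 0) 0.
Proof.
rewrite /ev -{1}(vsubmxK c) mul_row_col mul1mx mxE; congr (_ + _).
by rewrite !mxE.
Qed.

Lemma linval_ev (a : 'cV[R]_n) b x :
  ev (col_mx (- a) (const_mx b)) x = b - linval a x.
Proof.
by rewrite /ev mul_row_col mul1mx mulmxN /linval !mxE addrC.
Qed.

Lemma ev_sum (I : finType) (w : I -> R) (u : I -> 'rV[R]_n) c :
  \sum_i w i = 1 -> ev c (\sum_i w i *: u i) = \sum_i w i * ev c (u i).
Proof.
move=> w1; under [RHS]eq_bigr do rewrite evE mulrDr.
rewrite big_split/= -mulr_suml w1 mul1r evE; congr (_ + _).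
rewrite /linval mulmx_suml summxE; apply: eq_bigr => i _.
by rewrite -scalemxAl mxE.
Qed.

Lemma ev_cvx c x y t : ev c (x + t *: (y - x)) = ev c x + t * (ev c y - ev c x).
Proof.
rewrite !evE /linval mulmxDl -scalemxAl mulmxBl !mxE; ring.
Qed.

Lemma ev_hull c P y : (forall x, P x -> 0 <= ev c x) ->
  convex_hull P y -> 0 <= ev c y.
Proof.
move=> cP [k [w [p [pP w0 w1 ->]]]]; rewrite ev_sum//.
by apply: sumr_ge0 => i _; apply: mulr_ge0 => //; apply: cP.
Qed.

Lemma ev_aff0 c P y : (forall x, P x -> ev c x = 0) ->
  affine_hull P y -> ev c y = 0.
Proof.
move=> cP [k [w [p [pP w1 ->]]]]; rewrite ev_sum//.
by apply: big1 => i _; rewrite cP ?mulr0.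
Qed.

(** Faces in slack form: with [b - a x] in place of [a x <= b], a face is the zero set of a
    functional that is nonnegative on [P]. *)
Definition exposes c P F :=
  (forall x, P x -> 0 <= ev c x) /\ F = P `&` [set x | ev c x = 0].

Lemma exposes_linval (a : 'cV[R]_n) b P F :
  exposes (col_mx (- a) (const_mx b)) P F <->
  (forall x, P x -> linval a x <= b) /\ F = P `&` [set x | linval a x = b].
Proof.
have E : [set x | ev (col_mx (- a) (const_mx b)) x = 0] = [set x | linval a x = b].
  apply/seteqP; split=> x /=; rewrite linval_ev; last by move=> ->; rewrite subrr.
  by move/eqP; rewrite subr_eq0 => /eqP.
rewrite /exposes E; split=> -[h ->]; split=> // x /h; rewrite linval_ev subr_ge0//.
Qed.

Lemma ev_colE c : exists a b, c = col_mx (- a) (const_mx b).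
Proof.
exists (- usubmx c), (c (rshift n 0) 0); rewrite opprK -{1}(vsubmxK c).
by congr col_mx; apply/matrixP => i j; rewrite !mxE !ord1.
Qed.

Lemma is_faceP P F : is_face P F <-> exists c, exposes c P F.
Proof.
split=> [[a [b /exposes_linval e]]|[c]]; first by eexists; exact: e.
by have [a [b ->]] := ev_colE c => /exposes_linval; exists a, b.
Qed.

Lemma beyondP P F x :
  beyond P F x <-> exists2 c, exposes c P F & ev c x < 0.
Proof.
split=> [[a [b [ab FE bx]]]|[c]].
  by exists (col_mx (- a) (const_mx b)); [exact/exposes_linval|rewrite linval_ev subr_lt0].
have [a [b ->]] := ev_colE c => /exposes_linval[ab FE].
by rewrite linval_ev subr_lt0 => bx; exists a, b.
Qed.

Lemma beneathP P F x :
  beneath P F x <-> exists2 c, exposes c P F & 0 < ev c x.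
Proof.
split=> [[a [b [ab FE bx]]]|[c]].
  by exists (col_mx (- a) (const_mx b)); [exact/exposes_linval|rewrite linval_ev subr_gt0].
have [a [b ->]] := ev_colE c => /exposes_linval[ab FE].
by rewrite linval_ev subr_gt0 => bx; exists a, b.
Qed.

End Hulls.

Section Dimension.
Variables (R : realType) (n : nat).
Implicit Types (P F A B : set 'rV[R]_n) (x y : 'rV[R]_n) (c : 'cV[R]_(n + 1)).

Lemma affine_sub_vspace x x' (U U' : {vspace 'rV[R]_n}) :
  [set y | y - x \in U] `<=` [set y | y - x' \in U'] -> (U <= U')%VS.
Proof.
move=> s; apply/subvP => z zU.
have /= h1 : [set y | y - x' \in U'] (x + z) by apply: s; rewrite /= addrC addKr.
have /= h2 : [set y | y - x' \in U'] x by apply: s; rewrite /= subrr mem0v.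
by rewrite -[z](addrK (x - x')) rpredB// addrCA addrA [x + z]addrC [z + x]addrC.
Qed.

Lemma has_dim_uniq A d e : has_dim A d -> has_dim A e -> d = e.
Proof.
move=> [x [U [_ <- h]]] [x' [U' [_ <- h']]]; congr (\dim _).
apply/eqP; rewrite eqEsubv; apply/andP; split.
  by apply: (@affine_sub_vspace x x'); rewrite -h -h'.
by apply: (@affine_sub_vspace x' x); rewrite -h -h'.
Qed.

Lemma has_dim_lt c A B y k l :
  A `<=` B -> (forall x, A x -> ev c x = 0) -> B y -> ev c y != 0 ->
  has_dim A k -> has_dim B l -> (k < l)%N.
Proof.
move=> AB cA By cy [x [U [Ax <- h]]] [x' [U' [_ <- h']]].
have UU' : (U <= U')%VS.
  by apply: (@affine_sub_vspace x x'); rewrite -h -h'; exact: affine_hullS.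
rewrite ltn_neqAle dimvS// andbT eqn_leq dimvS//=; apply: contra cy => dU.
have {dU}UE : U = U' by apply/eqP; rewrite eqEdim UU'.
apply/eqP/(ev_aff0 cA); rewrite h /= UE.
have /= h1 : [set y | y - x' \in U'] y by rewrite -h'; exact: sub_affine_hull.
have /= h2 : [set y | y - x' \in U'] x.
  by rewrite -h'; apply: sub_affine_hull; exact: AB.
have -> : y - x = (y - x') - (x - x') by rewrite opprB addrA subrK.
by rewrite rpredB.
Qed.

Lemma vspace_of_mx k (Y : 'M[R]_(k, n)) : exists U : {vspace 'rV[R]_n},
  \dim U = \rank Y /\ forall y, (y \in U) = (y <= Y)%MS.
Proof.
pose b := [tuple row i (row_base Y) | i < \rank Y].
have bE (w : 'I_(\rank Y) -> R) :
    \sum_i w i *: b`_i = (\row_i w i) *m row_base Y.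
  rewrite mulmx_sum_row; apply: eq_bigr => i _.
  by rewrite -tnth_nth tnth_mktuple mxE.
have fb : free b.
  apply/freeP => w; rewrite bE => w0 i.
  have /row_freeP[D YD] := row_base_free Y.
  have : (\row_i w i) *m row_base Y *m D = 0 by rewrite w0 mul0mx.
  by rewrite -mulmxA YD mulmx1 => /matrixP/(_ 0 i); rewrite !mxE.
exists <<b>>%VS; split; first by move/eqP: fb; rewrite size_tuple.
move=> y; have -> : (y <= Y)%MS = (y <= row_base Y)%MS by rewrite eq_row_base.
apply/idP/idP => [/coord_span ->|].
  by rewrite bE submxMl.
case/submxP => D ->; rewrite mulmx_sum_row.
apply: rpred_sum => i _; apply/rpredZ/memv_span.
by apply/tnthP; exists i; rewrite tnth_mktuple.
Qed.

Definition hommx k (u : 'I_k -> 'rV[R]_n) : 'M_(k, n + 1) :=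
  \matrix_(i < k) row_mx (u i) 1%:M.

Lemma row_hommx k (u : 'I_k -> 'rV[R]_n) i : row i (hommx u) = row_mx (u i) 1%:M.
Proof. exact: rowK. Qed.

Lemma mul_hommx k (u : 'I_k -> 'rV[R]_n) (w : 'rV_k) :
  w *m hommx u = row_mx (\sum_i w 0 i *: u i) (\sum_i w 0 i)%:M.
Proof.
have -> : hommx u = row_mx (\matrix_i u i) (const_mx 1).
  by apply/row_matrixP => i; rewrite row_hommx row_row_mx rowK row_const; congr row_mx;
    apply/rowP => j; rewrite !mxE !ord1.
rewrite mul_mx_row mulmx_sum_row; congr row_mx.
  by apply: eq_bigr => i _; rewrite rowK.
apply/rowP => j; rewrite !mxE !ord1 eqxx mulr1n.
by apply: eq_bigr => i _; rewrite mxE mulr1.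
Qed.

Lemma row_mx1_inj (y y' : 'rV[R]_n) (a b : R) :
  row_mx y a%:M = row_mx y' b%:M :> 'rV_(n + 1) -> y = y' /\ a = b.
Proof.
case/eq_row_mx => -> /matrixP/(_ 0 0); rewrite !mxE eqxx !mulr1n; by split.
Qed.

Lemma affine_hull_hommx k (u : 'I_k -> 'rV[R]_n) y :
  affine_hull (range u) y <-> (row_mx y 1%:M <= hommx u)%MS.
Proof.
rewrite affine_hull_range; split=> [[w [w1 ->]]|/submxP[w]].
  apply/submxP; exists (\row_i w i); rewrite mul_hommx.
  by congr row_mx; [|congr _%:M; rewrite -w1]; apply: eq_bigr => i _; rewrite mxE.
by rewrite mul_hommx => /row_mx1_inj[-> e]; exists (w 0).
Qed.

Lemma affine_hull_idem A : affine_hull (affine_hull A) `<=` affine_hull A.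
Proof.
move=> y [k [w [p [pP w1 ->]]]].
have /choice[f fP] : forall i, exists f : {m & (('I_m -> R) * ('I_m -> 'rV[R]_n))%type},
  [/\ forall j, A ((projT2 f).2 j), \sum_j (projT2 f).1 j = 1
     & p i = \sum_j (projT2 f).1 j *: (projT2 f).2 j].
  move=> i; have [m [w' [p' [h1 h2 h3]]]] := pP i.
  by exists (existT _ m (w', p')).
pose I := {i : 'I_k & 'I_(projT1 (f i))}.
pose u (s : I) := (projT2 (f (tag s))).2 (tagged s).
have uA : range u `<=` A.
  by move=> _ [s _ <-]; have [h _ _] := fP (tag s); apply: h.
apply: (affine_hullS uA); apply/affine_hull_range.
exists (fun s => w (tag s) * (projT2 (f (tag s))).1 (tagged s)); split.
  rewrite -(sig_big_dep xpredT (fun=> xpredT) (fun i j => w i * (projT2 (f i)).1 j))/=.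
  by rewrite -w1; apply: eq_bigr => i _; have [_ h _] := fP i; rewrite -mulr_sumr h mulr1.
rewrite -(sig_big_dep xpredT (fun=> xpredT)
   (fun i j => (w i * (projT2 (f i)).1 j) *: (projT2 (f i)).2 j))/=.
apply: eq_bigr => i _; have [_ _ ->] := fP i.
by rewrite scaler_sumr; apply: eq_bigr => j _; rewrite scalerA.
Qed.

Lemma affine_hull_convex A : affine_hull (convex_hull A) = affine_hull A.
Proof.
apply/seteqP; split; last exact/affine_hullS/sub_convex_hull.
apply: subset_trans (@affine_hull_idem A).
exact/affine_hullS/convex_sub_affine.
Qed.

Lemma affine_hull_line A x y t :
  affine_hull A x -> affine_hull A y -> affine_hull A (x + t *: (y - x)).
Proof.
move=> Ax Ay; apply: affine_hull_idem.
apply: (affine_hullS (P := range (fun b : bool => if b then x else y))).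
  by move=> _ [[] _ <-].
apply/affine_hull_range; exists (fun b => if b then 1 - t else t).
rewrite !big_bool/=; split; first by rewrite subrK.
by rewrite scalerBl scale1r scalerBr addrA addrAC.
Qed.

(** The row space splits into the directions [u i - u ord0], at height 0, and the line of [u ord0],
    at height 1. *)
Lemma mxrank_hommx k (u : 'I_k.+1 -> 'rV[R]_n) :
  \rank (hommx u) = (\rank (\matrix_i (u i - u ord0))).+1.
Proof.
set Y := \matrix_i _.
have rY i : row i Y = u i - u ord0 by rewrite rowK.
pose Y0 : 'M[R]_(k.+1, n + 1) := row_mx Y 0.
pose x0 : 'rV[R]_(n + 1) := row_mx (u ord0) 1%:M.
have E : (hommx u :=: Y0 + x0)%MS.
  apply/eqmxP/andP; split.
    apply/row_subP => i; rewrite row_hommx.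
    have -> : row_mx (u i) 1%:M = row i Y0 + x0.
      by rewrite row_row_mx rY row0 add_row_mx subrK add0r.
    by apply: addmx_sub_adds; rewrite ?row_sub.
  rewrite addsmx_sub -[x0](row_hommx u ord0) row_sub andbT.
  apply/row_subP => i.
  have -> : row i Y0 = row i (hommx u) - row ord0 (hommx u).
    by rewrite !row_hommx row_row_mx rY row0 opp_row_mx add_row_mx subrr.
  by rewrite addmx_sub ?eqmx_opp ?row_sub.
rewrite E mxrank_disjoint_sum.
  have -> : \rank Y0 = \rank Y by rewrite rank_row_mx0.
  suff -> : \rank x0 = 1%N by rewrite addn1.
  rewrite rank_rV; suff -> : x0 != 0 by [].
  apply/eqP; rewrite -row_mx0 => /eq_row_mx[_ /matrixP/(_ 0 0)]/eqP.
  by rewrite !mxE oner_eq0.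
apply/eqP/rowV0P => z; rewrite sub_capmx => /andP[/submxP[D ->] /submxP[w]].
rewrite mul_mx_row mulmx0 [w]mx11_scalar mul_scalar_mx scale_row_mx.
case/eq_row_mx => -> /matrixP/(_ 0 0); rewrite !mxE eqxx mulr1 => <-.
by rewrite scale0r row_mx0.
Qed.

Lemma has_dim_hull k (u : 'I_k.+1 -> 'rV[R]_n) :
  has_dim (convex_hull (range u)) (\rank (hommx u)).-1.
Proof.
rewrite mxrank_hommx/=; set Y := \matrix_i _.
have [U [dU UE]] := vspace_of_mx Y.
exists (u ord0), U; split => //.
  by apply: sub_convex_hull; exists ord0.
rewrite affine_hull_convex; apply/seteqP; split=> y /=; rewrite UE.
  rewrite affine_hull_range => -[w [w1 ->]].
  apply/submxP; exists (\row_i w i); rewrite mulmx_sum_row.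
  under [RHS]eq_bigr do rewrite rowK mxE scalerBr.
  by rewrite sumrB -scaler_suml w1 scale1r.
case/submxP => w /eqP; rewrite subr_eq mulmx_sum_row => /eqP ->.
apply/affine_hull_hommx.
under eq_bigr do rewrite rowK.
have -> : row_mx (\sum_i w 0 i *: (u i - u ord0) + u ord0) 1%:M =
  w *m hommx u + (1 - \sum_i w 0 i) *: row ord0 (hommx u).
  rewrite mul_hommx row_hommx scale_row_mx add_row_mx scalemx1.
  congr row_mx; last by rewrite -raddfD/= addrC subrK.
  under eq_bigr do rewrite scalerBr.
  by rewrite sumrB -scaler_suml scalerBl scale1r addrAC addrA.
by rewrite addmx_sub ?submxMl// scalemx_sub// row_sub.
Qed.

Lemma has_dim_rank k (u : 'I_k -> 'rV[R]_n) d :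
  has_dim (convex_hull (range u)) d -> \rank (hommx u) = d.+1.
Proof.
case: k u => [|k] u; first by case=> x [U [[m [w [p [pu _ w1 _]]]] _ _]];
  case: m w p w1 pu => [|m] w p w1 pu; [by move: w1; rewrite big_ord0 => /eqP; rewrite eq_sym oner_eq0
   |by have [[]] := pu ord0].
by move=> /(has_dim_uniq (has_dim_hull u)) <-; rewrite mxrank_hommx.
Qed.

End Dimension.

(** * Face lattices *)

Section Faces.
Variables (R : realType) (n : nat).
Implicit Types (P F A B : set 'rV[R]_n) (x y : 'rV[R]_n) (c : 'cV[R]_(n + 1)).

Lemma polytope_range P : is_polytope P ->
  exists k (v : 'I_k -> 'rV[R]_n), P = convex_hull (range v).
Proof.
case=> V /finite_seqP[s ->] ->; exists (size s), (fun i => s`_i).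
congr convex_hull; apply/seteqP; split=> [x /= xs|_ [i _ <-] /=]; last exact: mem_nth.
have i_lt : (index x s < size s)%N by rewrite index_mem.
by exists (Ordinal i_lt) => //=; rewrite nth_index.
Qed.

Lemma range_polytope (I : finType) (v : I -> 'rV[R]_n) :
  is_polytope (convex_hull (range v)).
Proof. by exists (range v) => //; apply: finite_image; apply: finite_finset. Qed.

Lemma exposed_hull (I : finType) (u : I -> 'rV[R]_n) c F :
  exposes c (convex_hull (range u)) F ->
  F = convex_hull (u @` [set i | ev c (u i) = 0]).
Proof.
case=> c0 ->; apply/seteqP; split=> y.
  case=> /convex_hull_range[w [w0 w1 ->]] /=; rewrite ev_sum// => e.
  have {e}z i : w i != 0 -> ev c (u i) = 0.
    have cu j : 0 <= w j * ev c (u j).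
      by rewrite mulr_ge0// c0//; apply: sub_convex_hull; exists j.
    move/eqP: e; rewrite psumr_eq0// => /allP/(_ i); rewrite mem_index_enum.
    by move=> /(_ isT); rewrite /= mulf_eq0 => /orP[->|/eqP].
  have [i0 i00] : exists i, w i != 0.
    apply/existsP; apply: contraT; rewrite negb_exists => /forallP h.
    suff : \sum_i w i = 0 by rewrite w1 => /eqP; rewrite oner_eq0.
    by apply: big1 => i _; apply/eqP; have := h i; rewrite negbK.
  (* Points of weight zero may lie off the face; a generator on the face replaces them. *)
  pose s i := if w i == 0 then i0 else i.
  have -> : \sum_i w i *: u i = \sum_i w i *: u (s i).
    by apply: eq_bigr => i _; rewrite /s; case: eqP => // ->; rewrite !scale0r.
  exists #|I|, (w \o enum_val), (u \o s \o enum_val); split => //=.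
  - move=> i; exists (s (enum_val i)) => //=.
    by rewrite /s; case: ifPn => [_|]; exact: z.
  - by rewrite -w1 sum_enum_val.
  - by rewrite (sum_enum_val (fun i => w i *: u (s i))).
case=> k [w [p [pu w0 w1 ->]]]; split.
  by exists k, w, p; split => // i; have [j _ <-] := pu i; exists j.
rewrite /= ev_sum//; apply: big1 => i _.
by have [j /= jz <-] := pu i; rewrite jz mulr0.
Qed.

(** Repeating [u i0] in place of the generators off the face keeps the index type, so that results
    on hulls of families, such as [has_dim_hull], apply to faces. *)
Lemma exposed_range (I : finType) (u : I -> 'rV[R]_n) c F i0 :
  exposes c (convex_hull (range u)) F -> ev c (u i0) = 0 ->
  F = convex_hull (range (fun i => if ev c (u i) == 0 then u i else u i0)).
Proof.
move=> /exposed_hull -> z; congr convex_hull; apply/seteqP; split=> _ [i iz <-].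
  by exists i => //; move/eqP: iz => ->.
by case: ifPn => [/eqP iz'|_]; [exists i|exists i0].
Qed.

Lemma exposed_neq0 (I : finType) (u : I -> 'rV[R]_n) c F :
  exposes c (convex_hull (range u)) F -> F !=set0 -> exists i, ev c (u i) = 0.
Proof.
move=> /exposed_hull -> [_ [[|k] [w [p [pu _ w1 _]]]]].
  by move: w1; rewrite big_ord0 => /eqP; rewrite eq_sym oner_eq0.
by have [i iz _] := pu ord0; exists i.
Qed.

Lemma face_has_dim P F : is_polytope P -> is_face P F -> F !=set0 ->
  exists k, has_dim F k.
Proof.
move=> /polytope_range[k [v ->]] /is_faceP[c cF] F0.
have [i0 z] := exposed_neq0 cF F0.
case: k v i0 z cF => [|k] v i0 z cF; first by case: i0 z.
rewrite (exposed_range cF z); eexists; exact: has_dim_hull.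
Qed.

Lemma face_dim_lt P F F' k l : is_face P F -> is_face P F' -> F `<=` F' -> F <> F' ->
  has_dim F k -> has_dim F' l -> (k < l)%N.
Proof.
move=> /is_faceP[c [c0 FE]] /is_faceP[c' [_ F'E]] FF' nF.
have [y F'y nFy] : exists2 y, F' y & ~ F y.
  apply: contrapT => h; apply: nF; apply/seteqP; split=> // y F'y.
  by apply: contrapT => nFy; apply: h; exists y.
apply: (has_dim_lt (c := c) FF' _ F'y); first by rewrite FE => x [].
by apply/eqP => cy; apply: nFy; rewrite FE; split=> //; move: F'y; rewrite F'E => -[].
Qed.

Lemma face_self P : is_face P P.
Proof.
exists 0, 0; rewrite /linval; split=> [x _|]; first by rewrite mulmx0 mxE.
by apply/seteqP; split=> [x Px|x []//]; split=> //=; rewrite mulmx0 mxE.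
Qed.

Lemma face_empty P : is_face P set0.
Proof.
exists 0, 1; rewrite /linval; split=> [x _|]; first by rewrite mulmx0 mxE ler01.
apply/seteqP; split=> x //= -[_ /eqP]; by rewrite mulmx0 mxE eq_sym oner_eq0.
Qed.

Lemma face_sub P F : is_face P F -> F `<=` P.
Proof. by case=> a [b [_ ->]] x []. Qed.

(** Rank in the face lattice, shifted by one because the empty face has no dimension in nat. *)
Definition face_rank F k := if k is l.+1 then has_dim F l else F = set0.

Lemma face_rank_ex P F : is_polytope P -> is_face P F -> exists k, face_rank F k.
Proof.
move=> pP fF; have [->|F0] := eqVneq F set0; first by exists 0%N.
by have [|k Fk] := face_has_dim pP fF; [exact/set0P|exists k.+1].
Qed.

Lemma has_dim_neq0 F k : has_dim F k -> F !=set0.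
Proof. by case=> x [U [Fx _ _]]; exists x. Qed.

Lemma face_rank_uniq F k l : face_rank F k -> face_rank F l -> k = l.
Proof.
case: k l => [|k] [|l] //= => [->|+ F0|Fk Fl]; last by rewrite (has_dim_uniq Fk Fl).
- by move/has_dim_neq0 => -[].
- by rewrite F0 => /has_dim_neq0 => -[].
Qed.

Lemma face_rank_lt P F F' k l : is_face P F -> is_face P F' -> F `<=` F' -> F <> F' ->
  face_rank F k -> face_rank F' l -> (k < l)%N.
Proof.
case: k l => [|k] [|l] //= => fF fF' FF' nF; first by move=> F0 F'0; case: nF; rewrite F0 F'0.
  move=> /has_dim_neq0[x Fx] F'0.
  by have := FF' x Fx; rewrite F'0.
by rewrite ltnS; apply: face_dim_lt fF fF' FF' nF.
Qed.

Definition face_iso (I : finType) P (J : pred {set I}) (Phi : set 'rV[R]_n -> {set I}) :=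
  [/\ forall F, is_face P F -> J (Phi F),
      forall F F', is_face P F -> is_face P F' ->
        (F `<=` F' <-> Phi F \subset Phi F')
    & forall S, J S -> exists2 F, is_face P F & Phi F = S].

Lemma face_iso_inj (I : finType) P (J : pred {set I}) Phi F F' :
  face_iso P J Phi -> is_face P F -> is_face P F' -> Phi F = Phi F' -> F = F'.
Proof.
move=> [_ h _] fF fF' e; apply/seteqP; split.
  by apply/(h _ _ fF fF'); rewrite e.
by apply/(h _ _ fF' fF); rewrite e.
Qed.

(* The dimension of faces is strictly monotone, and d + 1 strict steps already
   lead from the empty face to P; so each of them raises the dimension by 1. *)
Lemma face_rank_iso (I : finType) P d (J : pred {set I}) (rho : {set I} -> nat) Phi :
  is_dpolytope d P -> face_iso P J Phi ->
  (forall S, J S -> (0 < rho S)%N ->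
     exists2 S', J S' & (S' \proper S) && (rho S == (rho S').+1)) ->
  (forall S, J S -> (rho S <= d)%N ->
     exists2 S', J S' & (S \proper S') && (rho S' == (rho S).+1)) ->
  forall F k, is_face P F -> face_rank F k -> rho (Phi F) = k.
Proof.
move=> [pP dP] iso pred succ.
have [JPhi mono surj] := iso.
have lb (r : nat) F k : is_face P F -> face_rank F k -> (r <= rho (Phi F))%N -> (r <= k)%N.
  elim: r F k => // r IHr F k fF Fk rF.
  have [|S' JS' /andP[pS' /eqP e]] := pred _ (JPhi _ fF); first by rewrite (leq_trans _ rF).
  have [F' fF' F'S] := surj _ JS'.
  have [k' F'k'] := face_rank_ex pP fF'.
  have := IHr _ _ fF' F'k'; rewrite F'S -ltnS -e => /(_ rF) rk'.
  apply: (leq_ltn_trans rk'); apply: (face_rank_lt fF' fF _ _ F'k' Fk).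
    by apply/mono => //; rewrite F'S proper_sub.
  by move=> FF'; move: pS'; rewrite -F'S FF' fintype.properxx.
have ub r F k : is_face P F -> face_rank F k -> (d.+1 - rho (Phi F) <= r)%N ->
    (k + (d.+1 - rho (Phi F)) <= d.+1)%N.
  elim: r F k => [|r IHr] F k fF Fk.
    rewrite leqn0 => /eqP ->; rewrite addn0.
    have [FP|nFP] := pselect (F = P).
      by rewrite (face_rank_uniq Fk (_ : face_rank F d.+1))// FP.
    have kd : (k < d.+1)%N; last exact: ltnW.
    exact: (face_rank_lt fF (face_self P) (face_sub fF) nFP Fk (dP : face_rank P d.+1)).
  have [rd|] := leqP (rho (Phi F)) d; last first.
    by rewrite -subn_eq0 => /eqP e _; apply: (IHr _ _ fF Fk); rewrite e.
  have [S' JS' /andP[pS' /eqP e]] := succ _ (JPhi _ fF) rd.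
  have [F' fF' F'S] := surj _ JS'.
  have [k' F'k'] := face_rank_ex pP fF'.
  have kk' : (k < k')%N.
    apply: (face_rank_lt fF fF' _ _ Fk F'k').
      by apply/mono => //; rewrite F'S proper_sub.
    by move=> FF'; move: pS'; rewrite -F'S FF' fintype.properxx.
  have := IHr _ _ fF' F'k'; rewrite F'S e; lia.
move=> F k fF Fk.
have := lb _ _ _ fF Fk (leqnn _).
have := ub _ _ _ fF Fk (leqnn _).
have : (k <= d.+1)%N.
  have [FP|nFP] := pselect (F = P).
    by rewrite (face_rank_uniq Fk (_ : face_rank F d.+1))// FP.
  apply: ltnW.
  exact: (face_rank_lt fF (face_self P) (face_sub fF) nFP Fk (dP : face_rank P d.+1)).
lia.
Qed.

Lemma card_eq_image_set (T : Type) (I : finType) (X : set T) (f : T -> I)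
    (J : {set I}) : {in X &, injective f} -> f @` X = [set` J] ->
  (X #= `I_#|J|)%card.
Proof.
move=> /inj_card_eq fX fXJ; rewrite card_eq_sym in fX; apply: card_eq_trans fX _.
rewrite fXJ; have -> : [set` J] = [set` [fset x | x in enum J]%fset].
  by apply/seteqP; split=> x /=; rewrite !inE mem_enum.
by apply/card_eq_fsetP; rewrite card_fseq undup_id ?enum_uniq// -cardE.
Qed.

Lemma fnum_face_iso (I : finType) P d (J : pred {set I}) (rho : {set I} -> nat) Phi :
  is_dpolytope d P -> face_iso P J Phi ->
  (forall S, J S -> (0 < rho S)%N ->
     exists2 S', J S' & (S' \proper S) && (rho S == (rho S').+1)) ->
  (forall S, J S -> (rho S <= d)%N ->
     exists2 S', J S' & (S \proper S') && (rho S' == (rho S).+1)) ->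
  forall m, fnum m P = #|[set S | J S & rho S == m.+1]|.
Proof.
move=> dP iso pred succ m; have rE := face_rank_iso dP iso pred succ.
have [JPhi _ surj] := iso.
apply: card_fset_set; apply: (card_eq_image_set (f := Phi)).
  by move=> F F' /set_mem[fF _] /set_mem[fF' _]; exact: (face_iso_inj iso).
apply/seteqP; split=> [_ [F [fF Fm] <-]|S] /=; rewrite inE.
  by rewrite JPhi//=; apply/eqP/(rE _ m.+1).
case/andP => JS rS; have [F fF FS] := surj _ JS; exists F => //; split => //.
have [k Fk] := face_rank_ex dP.1 fF.
by have := rE _ _ fF Fk; rewrite FS (eqP rS) => mk; rewrite -mk in Fk.
Qed.

End Faces.

(** * Facets *)

Section Farkas.
Variables (R : realFieldType) (N : nat).

Let dot (x : 'rV[R]_N) (c : 'cV[R]_N) : R := (x *m c) 0 0.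

Let dotDl x y c : dot (x + y) c = dot x c + dot y c.
Proof. by rewrite /dot mulmxDl mxE. Qed.

Let dotZl a x c : dot (a *: x) c = a * dot x c.
Proof. by rewrite /dot -scalemxAl mxE. Qed.

Let dotDr x c c' : dot x (c + c') = dot x c + dot x c'.
Proof. by rewrite /dot mulmxDr mxE. Qed.

Let dotZr a x c : dot x (a *: c) = a * dot x c.
Proof. by rewrite /dot -scalemxAr mxE. Qed.

(* When the functional f separating y from the first k generators is negative on
   the next one, recurse after projecting along it onto the kernel of f. *)
Lemma farkas k (v : nat -> 'rV[R]_N) (y : 'rV[R]_N) :
  (exists2 w : nat -> R, forall i, 0 <= w i & y = \sum_(i < k) w i *: v i) \/
  (exists2 c : 'cV[R]_N, forall i, (i < k)%N -> 0 <= (v i *m c) 0 0 & (y *m c) 0 0 < 0).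
Proof.
rewrite -/(dot _ _); elim: k v y => [|k IHk] v y.
  have [->|/rV0Pn[j yj]] := eqVneq y 0.
    by left; exists (fun=> 0) => //; rewrite big_ord0.
  right; exists (\col_i (- (y 0 j) *+ (i == j))) => //.
  rewrite /dot mxE (bigD1 j)//= mxE eqxx big1 => [|i ij]; last first.
    by rewrite mxE (negbTE ij) mulr0.
  by rewrite addr0 mulr1n mulrN oppr_lt0 -expr2 exprn_even_gt0.
have [[w w0 ->]|[f f0 fy]] := IHk v y.
  left; exists (fun i => if i == k then 0 else w i).
    by move=> i; case: ifP.
  rewrite big_ord_recr/= eqxx scale0r addr0; apply: eq_bigr => i _.
  by rewrite ltn_eqF.
have [fk|fk] := leP 0 (dot (v k) f).
  by right; exists f => // i; rewrite ltnS leq_eqVlt => /orP[/eqP ->|/f0].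
pose pr x := - dot (v k) f *: x + dot x f *: v k.
have [[w w0 e]|[g g0 gy]] := IHk (pr \o v) (pr y).
  (* The coefficient of [v k] for which [f] agrees on both sides; it is nonnegative since [f] is
     negative at [y] and nonnegative at the first k generators. *)
  pose b := (\sum_(i < k) w i * dot (v i) f - dot y f) / - dot (v k) f.
  left; exists (fun i => if i == k then b else w i).
    move=> i; case: ifP => // _; rewrite divr_ge0 ?oppr_ge0 ?(ltW fk)// subr_ge0.
    apply: (le_trans (ltW fy)); apply: sumr_ge0 => j _.
    by rewrite mulr_ge0// f0.
  rewrite big_ord_recr/= eqxx.
  have -> : \sum_(i < k) (if i == k :> nat then b else w i) *: v i =
      \sum_(i < k) w i *: v i.
    by apply: eq_bigr => i _; rewrite ltn_eqF.
  have fn : - dot (v k) f != 0 by rewrite oppr_eq0 lt_eqF.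
  apply: (scalerI fn); rewrite scalerDr scalerA mulrCA divff// mulr1.
  move: e; rewrite {1}/pr => /eqP; rewrite eq_sym -subr_eq eq_sym => /eqP ->.
  have -> : \sum_(i < k) w i *: (pr \o v) i =
     - dot (v k) f *: (\sum_(i < k) w i *: v i) + (\sum_(i < k) w i * dot (v i) f) *: v k.
    rewrite scaler_sumr scaler_suml -big_split/=; apply: eq_bigr => i _.
    by rewrite /pr scalerDr !scalerA mulrC.
  by rewrite scalerBl addrA.
(* The pullback of [g] along [pr]; it vanishes at [v k]. *)
right; set c := - dot (v k) f *: g + dot (v k) g *: f.
have E x : dot x c = dot (pr x) g by rewrite dotDl dotDr !dotZl !dotZr; ring.
exists c => [i|]; rewrite -/(dot _ _) E//.
rewrite ltnS leq_eqVlt => /orP[/eqP ->|/g0//].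
by rewrite dotDl !dotZl mulNr addrC subrr.
Qed.

End Farkas.

(** * A polytope as the intersection of its facet half-spaces *)

Section FacetDescription.
Variables (R : realType) (n : nat).
Implicit Types (P F A B : set 'rV[R]_n) (x y : 'rV[R]_n) (c : 'cV[R]_(n + 1)).

Lemma convex_hull_rangeS (I J : finType) (u : I -> 'rV[R]_n) (v : J -> 'rV[R]_n) :
  (forall i, convex_hull (range v) (u i)) ->
  convex_hull (range u) `<=` convex_hull (range v).
Proof.
move=> uv y /convex_hull_range[w [w0 w1 ->]].
have /choice[a aE] : forall i, exists a : J -> R,
  [/\ forall j, 0 <= a j, \sum_j a j = 1 & u i = \sum_j a j *: v j].
  by move=> i; have /convex_hull_range := uv i.
apply/convex_hull_range; exists (fun j => \sum_i w i * a i j); split.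
- by move=> j; apply: sumr_ge0 => i _; have [a0 _ _] := aE i; rewrite mulr_ge0.
- rewrite exchange_big/= -w1; apply: eq_bigr => i _.
  by have [_ a1 _] := aE i; rewrite -mulr_sumr a1 mulr1.
- under [RHS]eq_bigr do rewrite scaler_suml; rewrite exchange_big/=.
  apply: eq_bigr => i _; have [_ _ ->] := aE i.
  by rewrite scaler_sumr; apply: eq_bigr => j _; rewrite scalerA.
Qed.

Lemma evD c c' x : ev (c + c') x = ev c x + ev c' x.
Proof. by rewrite /ev mulmxDr mxE. Qed.

Lemma evZ t c x : ev (t *: c) x = t * ev c x.
Proof. by rewrite /ev -scalemxAr mxE. Qed.

Lemma ev_sumc (I : Type) (r : seq I) (p : pred I) (c : I -> 'cV[R]_(n + 1)) x :
  ev (\sum_(i <- r | p i) c i) x = \sum_(i <- r | p i) ev (c i) x.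
Proof. by rewrite /ev mulmx_sumr summxE. Qed.

(** Farkas' lemma in homogeneous coordinates, where the last coordinate makes the weights sum to
    1. *)
Lemma separation k (v : 'I_k -> 'rV[R]_n) y : ~ convex_hull (range v) y ->
  exists2 c, forall i, 0 <= ev c (v i) & ev c y < 0.
Proof.
move=> ny; pose h i := row_mx (if insub i is Some j then v j else 0) 1%:M : 'rV[R]_(n + 1).
have hE (i : 'I_k) : h i = row_mx (v i) 1%:M by rewrite /h valK.
have [[w w0 e]|[c cv cy]] := farkas k h (row_mx y 1%:M); last first.
  by exists c => // i; have := cv i (ltn_ord i); rewrite hE.
case: ny; apply/convex_hull_range; exists (fun i => w (nat_of_ord i)).
have : row_mx y 1%:M = (\row_i w (nat_of_ord i)) *m hommx v.
  by rewrite e mulmx_sum_row; apply: eq_bigr => i _; rewrite row_hommx mxE hE.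
rewrite mul_hommx => /row_mx1_inj[-> e1]; split => //.
  by rewrite e1; apply: eq_bigr => i _; rewrite mxE.
by apply: eq_bigr => i _; rewrite mxE.
Qed.

(** The row space is spanned by the generators on the hyperplane c = 0; if there are any and [c] is
    nonnegative on the hull, the rank is one more than the dimension of the exposed face. *)
Definition contact k (v : 'I_k -> 'rV[R]_n) c : 'M[R]_(k, n + 1) :=
  \matrix_i (if ev c (v i) == 0 then row_mx (v i) 1%:M else 0).

Lemma contact_row k (v : 'I_k -> 'rV[R]_n) c i :
  ev c (v i) = 0 -> (row_mx (v i) 1%:M <= contact v c)%MS.
Proof. by move=> /eqP e; have := row_sub i (contact v c); rewrite rowK e. Qed.

Lemma contact_sub k (v : 'I_k -> 'rV[R]_n) c m (B : 'M[R]_(m, n + 1)) :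
  (forall i, ev c (v i) = 0 -> row_mx (v i) 1%:M <= B)%MS ->
  (contact v c <= B)%MS.
Proof.
move=> h; apply/row_subP => i; rewrite rowK; case: eqP => [|_]; first exact: h.
exact: sub0mx.
Qed.

(* Rotate the hyperplane c = 0 about its contact points and y until it hits a
   new vertex. *)
Lemma contact_increase k (v : 'I_k -> 'rV[R]_n) c y :
  (forall i, 0 <= ev c (v i)) -> ev c y < 0 ->
  ((\rank (contact v c)).+1 < \rank (hommx v))%N ->
  exists c', [/\ forall i, 0 <= ev c' (v i), ev c' y < 0
    & (\rank (contact v c) < \rank (contact v c'))%N].
Proof.
move=> c0 cy rk.
pose K := (contact v c + row_mx y 1%:M)%MS.
(* By the rank hypothesis the contact points and [y] do not span all generators, so some functional
   [b] vanishes on the former but not on the latter. *)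
have XK : ~~ (hommx v <= K)%MS.
  apply: contraL rk => /mxrankS XK; rewrite -leqNgt (leq_trans XK)//.
  apply: leq_trans (mxrank_adds_leqif _ _) _.
  by rewrite -[leqRHS]addn1 leq_add2l rank_leq_row.
have [b [bK [i1 bi1]]] : exists b : 'cV[R]_(n + 1),
    (forall z : 'rV_(n + 1), (z <= K)%MS -> z *m b = 0) /\ exists i, ev b (v i) < 0.
  move: XK => /row_subPn[i]; rewrite row_hommx submxE => /rV0Pn[j nz].
  pose b := col j (cokermx K).
  have bK (z : 'rV_(n + 1)) : (z <= K)%MS -> z *m b = 0.
    by case/submxP => D ->; rewrite /b colE mulmxA -(mulmxA D) mulmx_coker mulmx0 mul0mx.
  have eb : ev b (v i) != 0.
    by apply: contraNneq nz; rewrite /ev /b colE mulmxA -colE mxE => ->.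
  case: (ltgtP (ev b (v i)) 0) => [lt0|gt0|e]; last by rewrite e eqxx in eb.
    by exists b; split => //; exists i.
  exists (- b); split => [z /bK|]; first by rewrite mulmxN => ->; rewrite oppr0.
  by exists i; rewrite /ev mulmxN mxE oppr_lt0.
have bC i : ev c (v i) = 0 -> ev b (v i) = 0.
  move=> /contact_row h; rewrite /ev bK ?mxE//.
  by apply: submx_trans h _; apply: addsmxSl.
have by0 : ev b y = 0 by rewrite /ev bK ?mxE// addsmxSr.
pose f i := ev c (v i) / - ev b (v i).
(* Ratio test: [f i2] is the least [t] at which [c + t *: b] vanishes at a generator where [b] is
   negative, so no generator has become negative yet. *)
case: (@Order.TotalTheory.arg_minP _ _ _ i1 (fun i => ev b (v i) < 0) f bi1) => i2 bi2 min2.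
have t0 : 0 <= f i2 by rewrite divr_ge0// oppr_ge0 ltW.
have eE x : ev (c + f i2 *: b) x = ev c x + f i2 * ev b x by rewrite evD evZ.
exists (c + f i2 *: b); split.
- move=> i; rewrite eE; have [bi|bi] := leP 0 (ev b (v i)).
    by rewrite addr_ge0// mulr_ge0.
  have := min2 i bi; rewrite {2}/f ler_pdivlMr ?oppr_gt0//.
  by rewrite mulrN -subr_ge0 opprK.
- by rewrite eE by0 mulr0 addr0.
have new : ev (c + f i2 *: b) (v i2) = 0.
  by rewrite eE /f invrN mulrN mulNr divfK ?subrr// lt_eqF.
apply: rank_ltmx; rewrite ltmxE; apply/andP; split.
  apply: contact_sub => i ci; apply: contact_row.
  by rewrite eE ci bC// mulr0 addr0.
apply/negP => /(submx_trans (contact_row new)) h.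
have : ev b (v i2) = 0 by rewrite /ev bK ?mxE// (submx_trans h)// addsmxSl.
by move=> e; rewrite e ltxx in bi2.
Qed.

Lemma contact_hull k (v : 'I_k -> 'rV[R]_n) c F i0 :
  exposes c (convex_hull (range v)) F -> ev c (v i0) = 0 ->
  has_dim F (\rank (contact v c)).-1.
Proof.
move=> cF z; have -> := exposed_range cF z; set u := fun i => _.
have -> : \rank (contact v c) = \rank (hommx u).
  apply/eqP; rewrite eqn_leq; apply/andP; split; apply: mxrankS.
    apply: contact_sub => i ci; have := row_sub i (hommx u).
    by rewrite row_hommx /u ci eqxx.
  by apply/row_subP => i; rewrite row_hommx /u; case: eqP => [e|_]; exact: contact_row.
have gen m (u' : 'I_m -> 'rV[R]_n) (i : 'I_m) :
    has_dim (convex_hull (range u')) (\rank (hommx u')).-1.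
  by case: m u' i => [|m] u' i; [case: i|exact: has_dim_hull].
exact: gen.
Qed.

(** A separating hyperplane is rotated until its contact points have rank d + 1. As [y] stays
    strictly on the negative side and lies in the affine hull, the exposed face is never all of [P],
    hence it is a facet. *)
Lemma facet_separation k (v : 'I_k -> 'rV[R]_n) d y :
  has_dim (convex_hull (range v)) d.+1 -> affine_hull (range v) y ->
  ~ convex_hull (range v) y ->
  exists c F, [/\ exposes c (convex_hull (range v)) F, has_dim F d & ev c y < 0].
Proof.
set P := convex_hull _ => dP ay ny.
have rX : \rank (hommx v) = d.+2 := has_dim_rank dP.
have [c [c0 cy rc]] : exists c, [/\ forall i, 0 <= ev c (v i), ev c y < 0
    & (d.+1 <= \rank (contact v c))%N].
  have [c c0 cy] := separation ny.
  have : (d.+1 - \rank (contact v c) <= d.+1)%N by rewrite leq_subr.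
  elim: {2}d.+1 c c0 cy => [|j IHj] c c0 cy.
    by rewrite leqn0 subn_eq0 => rc; exists c.
  have [rc|rc dj] := leqP d.+1 (\rank (contact v c)); first by exists c.
  have [|c' [c'0 c'y rc']] := contact_increase c0 cy; first by rewrite rX.
  apply: (IHj c') => //; move: dj rc'; lia.
have [i0 z] : exists i, ev c (v i) = 0.
  apply: contrapT => h; suff e : contact v c = 0 by rewrite e mxrank0 in rc.
  apply/row_matrixP => i; rewrite rowK row0; case: eqP => // e.
  by case: h; exists i.
have cF : exposes c P (P `&` [set x | ev c x = 0]).
  split=> // x; apply: ev_hull => _ [i _ <-]; exact: c0.
exists c, (P `&` [set x | ev c x = 0]); split => //.
have dF := contact_hull cF z.
suff : ((\rank (contact v c)).-1 < d.+1)%N.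
  by move=> h; have <- : (\rank (contact v c)).-1 = d by move: h rc; lia.
apply: (face_dim_lt _ (face_self P) _ _ dF dP).
- by apply/is_faceP; exists c.
- by move=> x [].
- move=> FP; move: cy; rewrite (ev_aff0 (c := c) _ ay) ?ltxx// => x [i _ <-].
  have : P (v i) by apply: sub_convex_hull; exists i.
  by rewrite -FP => -[].
Qed.

(** Two functionals exposing the same facet are positive multiples of each other on the affine hull:
    the combination [e] that vanishes on the facet and at one point [z] off it vanishes on all of
    [P]. *)
Lemma exposes_facet_sign k (v : 'I_k -> 'rV[R]_n) d F c c' y :
  has_dim (convex_hull (range v)) d.+1 -> affine_hull (range v) y ->
  exposes c (convex_hull (range v)) F -> exposes c' (convex_hull (range v)) F ->
  has_dim F d -> ev c y < 0 -> ev c' y < 0.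
Proof.
set P := convex_hull _ => dP ay cF c'F dF cy.
have pP : is_polytope P := range_polytope v.
have [z Pz nz] : exists2 z, P z & ~ F z.
  apply: contrapT => h; have FP : F = P.
    apply/seteqP; split=> x; first by rewrite cF.2 => -[].
    by move=> Px; apply: contrapT => nx; apply: h; exists x.
  by rewrite FP in dF; have := has_dim_uniq dP dF => /eqP; rewrite eqn_leq ltnn.
have pos e : exposes e P F -> 0 < ev e z.
  move=> [e0 FE]; rewrite lt_def e0// andbT; apply/eqP => ez.
  by apply: nz; rewrite FE.
have [a0 b0] := (pos _ cF, pos _ c'F).
pose e := ev c' z *: c - ev c z *: c'.
have eE x : ev e x = ev c' z * ev c x - ev c z * ev c' x.
  by rewrite /e evD evZ -scaleN1r evZ evZ mulN1r.
suff eP x : P x -> ev e x = 0.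
  have : ev e y = 0 by apply: (ev_aff0 _ ay) => _ [i _ <-]; apply/eP/sub_convex_hull; exists i.
  rewrite eE => /eqP; rewrite subr_eq0 => /eqP h.
  by rewrite -(pmulr_rlt0 _ a0) -h pmulr_rlt0.
move=> Px; apply/eqP; apply: contraT => ex.
have [i0 i00] := exposed_neq0 cF (has_dim_neq0 dF).
pose u i := if ev c (v i) == 0 then v i else v i0.
have FE : F = convex_hull (range u) := exposed_range cF i00.
pose u' (i : 'I_k.+1) := if unlift ord0 i is Some j then u j else z.
have u'0 : u' ord0 = z by rewrite /u' unlift_none.
have u'S j : u' (lift ord0 j) = u j by rewrite /u' liftK.
have Fu j : F (u j) by rewrite FE; apply: sub_convex_hull; exists j.
(* The hull of [F] and [z]. It has dimension above d, but below d + 1 if [e], zero on it, is nonzero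
   somewhere on [P]. *)
pose A := convex_hull (range u').
have dA := has_dim_hull u'.
have FA : F `<=` A.
  rewrite FE; apply: convex_hull_rangeS => j; apply: sub_convex_hull.
  by exists (lift ord0 j).
have AP : A `<=` P.
  apply: convex_hull_rangeS => i; case: (unliftP ord0 i) => [j|] ->; rewrite ?u'0// u'S.
  by have := Fu j; rewrite cF.2 => -[].
have eA t : A t -> ev e t = 0.
  move=> /convex_sub_affine; apply: ev_aff0 => _ [i _ <-].
  case: (unliftP ord0 i) => [j|] ->; rewrite ?u'0 ?u'S eE; last by ring.
  have := Fu j; rewrite {1}cF.2 => -[_ /= ->].
  by have := Fu j; rewrite {1}c'F.2 => -[_ /= ->]; rewrite !mulr0 subrr.
have l1 := has_dim_lt AP eA Px ex dA dP.
have Az : A z by apply: sub_convex_hull; exists ord0.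
have l2 : (d < (\rank (hommx u')).-1)%N.
  apply: (has_dim_lt FA (c := c) _ Az _ dF dA); last by rewrite gt_eqF.
  by move=> t; rewrite cF.2 => -[].
by move: l1 l2; lia.
Qed.

(** One exposing functional is chosen per facet. [facet_separation] may provide another one for the
    same facet, and [exposes_facet_sign] transfers its sign at [y]. *)
Lemma facet_description k (v : 'I_k -> 'rV[R]_n) d N :
  has_dim (convex_hull (range v)) d.+1 ->
  fnum d (convex_hull (range v)) = N.+1 ->
  exists c : 'I_N.+1 -> 'cV[R]_(n + 1),
    [/\ forall i x, convex_hull (range v) x -> 0 <= ev (c i) x,
        forall i, exists2 x, convex_hull (range v) x & ev (c i) x != 0
      & forall y, affine_hull (range v) y -> (forall i, 0 <= ev (c i) y) ->
          convex_hull (range v) y].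
Proof.
set P := convex_hull _ => dP; rewrite /fnum; set X := [set F | _] => cX.
(* On an infinite set [fset_set] would give count 0. *)
have finX : finite_set X.
  apply: contrapT => inf; move: cX; rewrite /fset_set; by case: pselect.
pose F (i : 'I_N.+1) := nth set0 (enum_fset (fset_set X)) i.
have XF i : X (F i).
  have : F i \in fset_set X by apply: mem_nth; rewrite [size _]cX.
  by rewrite in_fset_set// => /set_mem.
have /choice[c cE] : forall i, exists c, exposes c P (F i).
  by move=> i; have [/is_faceP[c cF] _] := XF i; exists c.
exists c; split.
- by move=> i x; have [h _] := cE i; apply: h.
- move=> i; apply: contrapT => h; have [_ dF] := XF i.
  have FP : F i = P.
    rewrite (cE i).2; apply/seteqP; split=> [x []//|x Px]; split=> //=.
    by apply/eqP; apply: contraT => nz; case: h; exists x.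
  by rewrite FP in dF; have := has_dim_uniq dP dF => /eqP; rewrite eqn_leq ltnn.
- move=> y ay cy; apply: contrapT => ny.
  have [c' [F' [c'F' dF' c'y]]] := facet_separation dP ay ny.
  have XF' : F' \in fset_set X.
    by rewrite in_fset_set//; apply/mem_set; split=> //; apply/is_faceP; exists c'.
  have il : (index F' (enum_fset (fset_set X)) < N.+1)%N by rewrite -cX index_mem.
  have FE : F (Ordinal il) = F' by rewrite /F/= nth_index.
  have := cE (Ordinal il); rewrite FE => cF'.
  have := exposes_facet_sign dP ay c'F' cF' dF' c'y.
  by rewrite ltNge cy.
Qed.

End FacetDescription.

(** * Slack models *)

Section SlackModel.
Variables (R : realType) (n : nat) (I : finType).
Implicit Types (P F : set 'rV[R]_n) (x y : 'rV[R]_n) (c : I -> 'cV[R]_(n + 1)).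

(* The slacks of the points of P, up to scaling, are the nonzero nonnegative
   solutions of the equation w. *)
Definition slack_model P c (w : I -> R) :=
  [/\ forall x, P x -> (forall i, 0 <= ev (c i) x) /\ \sum_i w i * ev (c i) x = 0,
      forall x, P x -> exists i, ev (c i) x != 0,
      forall s : I -> R, (forall i, 0 <= s i) -> \sum_i w i * s i = 0 ->
        (exists i, s i != 0) ->
        exists2 x, P x & forall i, (ev (c i) x != 0) = (s i != 0)
    & forall y, affine_hull P y -> (forall i, 0 <= ev (c i) y) -> P y].

Definition face_supp c F : {set I} :=
  [set i | `[< exists2 x, F x & ev (c i) x != 0 >]]%SET.

Lemma face_suppP c F i :
  reflect (exists2 x, F x & ev (c i) x != 0) (i \in face_supp c F).
Proof. by rewrite inE; exact: asboolP. Qed.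

(* The segment from x to a point of F with full support can be prolonged within
   P beyond that point. *)
Lemma slack_face P c w F x : slack_model P c w -> is_face P F -> F !=set0 ->
  P x -> (forall i, ev (c i) x != 0 -> i \in face_supp c F) -> F x.
Proof.
move=> [m1 _ _ m4] /is_faceP[a [a0 FE]] [x0 Fx0] Px sx.
have FP z : F z -> P z by rewrite FE => -[].
have cF i z : F z -> 0 <= ev (c i) z by move=> /FP /m1 [].
have /choice[p pE] : forall i, exists z, F z /\ (i \in face_supp c F -> ev (c i) z != 0).
  move=> i; case: (boolP (i \in face_supp c F)) => [/face_suppP[z Fz nz]|_]; first by exists z.
  by exists x0.
pose u o := if o is Some i then p i else x0.
have Fu o : F (u o) by case: o => [i|] //=; have [] := pE i.
pose k : R := #|{: option I}|%:R.
have k0 : 0 < k by rewrite ltr0n card_option.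
pose wk (o : option I) := k^-1.
have wk1 : \sum_o wk o = 1.
  by rewrite sumr_const -[LHS]mulr_natl divff// gt_eqF.
(* A barycentre of witnesses: it lies on [F], and its slack is positive at every index of
   [face_supp c F]. *)
pose q := \sum_o wk o *: u o.
have aq : affine_hull P q.
  apply: (affine_hullS (P := range u)); first by move=> _ [o _ <-]; exact: FP.
  by apply/affine_hull_range; exists wk.
have evq b : ev b q = k^-1 * \sum_o ev b (u o) by rewrite ev_sum// mulr_sumr.
have q0 i : 0 <= ev (c i) q.
  rewrite evq mulr_ge0 ?invr_ge0 ?(ltW k0)//; apply: sumr_ge0 => o _; exact: cF.
have qpos i : i \in face_supp c F -> 0 < ev (c i) q.
  move=> iF; rewrite evq mulr_gt0 ?invr_gt0//.
  rewrite (bigD1 (Some i))//= ltr_pwDl//; last by apply: sumr_ge0 => o _; exact: cF.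
  by rewrite lt_def cF ?andbT; have [Fp /(_ iF)] := pE i.
have aq0 : ev a q = 0.
  by rewrite evq big1 ?mulr0// => o _; have := Fu o; rewrite FE => -[].
have x0' i : 0 <= ev (c i) x by have [+ _] := m1 _ Px.
(* [S] bounds the ratios of the slacks of [x] to those of [q] on the support, so a step past [q] of
   relative length 1 / (1 + S) keeps all slacks nonnegative. *)
pose S := \sum_i ev (c i) x / ev (c i) q.
have S0 : 0 <= S by apply: sumr_ge0 => i _; rewrite divr_ge0.
pose t := - (1 + S)^-1.
have yP : P (q + t *: (x - q)).
  apply: m4 => [|i]; first by apply: affine_hull_line => //; exact: sub_affine_hull.
  rewrite ev_cvx; have [iF|iF] := boolP (i \in face_supp c F); last first.
    have -> : ev (c i) x = 0 by apply/eqP; apply: contraNT iF => /sx.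
    suff -> : ev (c i) q = 0 by rewrite subrr mulr0 addr0.
    rewrite evq big1 ?mulr0// => o _; apply/eqP; apply: contraNT iF => nz.
    by apply/face_suppP; exists (u o).
  have S1 : 0 < 1 + S by rewrite ltr_pwDl.
  have xS : ev (c i) x <= S * ev (c i) q.
    rewrite -ler_pdivrMr ?qpos// /S (bigD1 i)//= lerDl.
    by apply: sumr_ge0 => j _; rewrite divr_ge0.
  have -> : ev (c i) q + t * (ev (c i) x - ev (c i) q) =
      (1 + S)^-1 * ((S * ev (c i) q - ev (c i) x) + ev (c i) q *+ 2).
    by rewrite /t; field; rewrite gt_eqF.
  by rewrite mulr_ge0 ?invr_ge0 ?(ltW S1)// addr_ge0 ?subr_ge0// mulrn_wge0.
have : 0 <= ev a (q + t *: (x - q)) by exact: a0.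
rewrite ev_cvx aq0 add0r subr0 /t mulNr oppr_ge0 pmulr_rle0 ?invr_gt0 ?ltr_pwDl// => ax.
by rewrite FE; split=> //=; apply/eqP; rewrite eq_le ax a0.
Qed.

Lemma slack_face_iso P c w : slack_model P c w ->
  face_iso P (balanced [set i | 0 < w i]%SET [set i | w i < 0]%SET) (face_supp c).
Proof.
move=> m; have [m1 m2 m3 _] := m.
have FP F z : is_face P F -> F z -> P z by move=> fF; exact: (face_sub fF).
split.
- move=> F fF; apply/balanced_supp.
  (* One solution per index, the slacks of a witness or zero; their sum is supported on all of
     [face_supp c F]. *)
  have /choice[p pE] : forall i, exists s : I -> R, [/\ forall j, 0 <= s j,
      \sum_j w j * s j = 0, forall j, s j != 0 -> j \in face_supp c F
      & i \in face_supp c F -> s i != 0].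
    move=> i; case: (boolP (i \in face_supp c F)) => [/face_suppP[z Fz nz]|_]; last first.
      exists (fun=> 0); split=> //; last by move=> ?; rewrite eqxx.
      by apply: big1 => j _; rewrite mulr0.
    exists (fun j => ev (c j) z); have [z0 zw] := m1 _ (FP _ _ fF Fz); split=> //.
    by move=> j nzj; apply/face_suppP; exists z.
  have p0 i j : 0 <= p i j by have [] := pE i.
  exists (fun j => \sum_i p i j); split.
  + by move=> j; apply: sumr_ge0.
  + under eq_bigr do rewrite mulr_sumr.
    rewrite exchange_big/=; apply: big1 => i _; by have [_ -> ] := pE i.
  + apply/setP => j; rewrite inE psumr_neq0//; apply/hasP/idP => [[i _ /= pij]|jF].
      by have [_ _ h _] := pE i; apply: h; rewrite gt_eqF.
    exists j; first exact: mem_index_enum.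
    by rewrite /= lt_def p0 andbT; have [_ _ _ ->] := pE j.
- move=> F F' fF fF'; split=> [FF'|/fintype.subsetP sFF' x Fx].
    by apply/fintype.subsetP => i /face_suppP[x Fx nz]; apply/face_suppP; exists x => //; exact: FF'.
  have Px := FP _ _ fF Fx.
  have sx i : ev (c i) x != 0 -> i \in face_supp c F' by move=> nz; apply/sFF'/face_suppP; exists x.
  apply: (slack_face m fF') => //; have [i /sx/face_suppP[y Fy _]] := m2 _ Px; by exists y.
- move=> J /balanced_supp[s [s0 ws <-]].
  have [[i si]|h] := pselect (exists i, s i != 0); last first.
    exists set0; first exact: face_empty.
    apply/setP => i; apply/face_suppP/idP => [[]//|]; rewrite inE => si; by case: h; exists i.
  have [x Px sx] := m3 _ s0 ws (ex_intro _ i si).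
  have c0 y : P y -> forall j, s j == 0 -> 0 <= ev (c j) y by move=> /m1[].
  (* The intersection of the facets whose slack vanishes in [s], exposed by the sum of those
     slacks. *)
  exists (P `&` [set y | ev (\sum_(j | s j == 0) c j) y = 0]).
    apply/is_faceP; exists (\sum_(j | s j == 0) c j); split=> // y Py.
    by rewrite ev_sumc sumr_ge0// => j; exact: c0.
  apply/setP => j; rewrite [RHS]inE; apply/face_suppP/idP => [[y [Py /= y0] nz]|sj].
    apply: contraNN nz => sj; move/eqP: y0; rewrite ev_sumc psumr_eq0; last exact: c0.
    by move/allP/(_ j); rewrite mem_index_enum sj => /(_ isT).
  exists x; last by rewrite sx.
  split=> //=; rewrite ev_sumc big1// => l /eqP sl.
  by apply/eqP; have := sx l; rewrite sl eqxx => /negbT; rewrite negbK.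
Qed.

End SlackModel.

(** * The linear equation satisfied by the facet slacks *)

Section PolytopeSlack.
Variables (R : realType) (n : nat).
Implicit Types (P F : set 'rV[R]_n) (x y : 'rV[R]_n).

Lemma hull_bounded (I : finType) (v : I -> 'rV[R]_n) j :
  exists B, forall x, convex_hull (range v) x -> `|x 0 j| <= B.
Proof.
exists (\sum_i `|v i 0 j|) => x /convex_hull_range[w [w0 w1 ->]].
rewrite summxE; apply: le_trans (ler_norm_sum _ _ _) _; apply: ler_sum => i _.
rewrite mxE normrM ler_piMl// ger0_norm// -w1 (bigD1 i)//= lerDl.
by apply: sumr_ge0.
Qed.

Lemma hull_no_ray (I : finType) (v : I -> 'rV[R]_n) x u :
  (forall t, 0 <= t -> convex_hull (range v) (x + t *: u)) -> u = 0.
Proof.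
move=> ray; apply/rowP => j; rewrite mxE; apply/eqP; apply: contraT => uj.
have [B hB] := hull_bounded v j.
have B0 : 0 <= B by have := hB _ (ray 0 (lexx 0)); apply: le_trans.
have ux : 0 < `|u 0 j| by rewrite normr_gt0.
pose t := (B + B + 1) / `|u 0 j|.
have t0 : 0 <= t by rewrite divr_ge0 ?addr_ge0 // ltW.
have h1 := hB _ (ray t t0).
have := hB _ (ray 0 (lexx 0)); rewrite scale0r addr0 => h2.
have : `|t * u 0 j| <= B + B.
  have -> : t * u 0 j = (x + t *: u) 0 j - x 0 j by rewrite !mxE addrC addKr.
  by apply: le_trans (ler_normB _ _) _; apply: lerD.
by rewrite normrM ger0_norm// divfK ?gt_eqF// leNgt ltrDl ltr01.
Qed.

(** The slack map [L] is injective on the row space of [hommx v], since the cone over [P] is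
    pointed. Its image therefore has dimension d + 2 among d + 3 slacks, and [g] is the equation of
    this hyperplane. A nonzero nonnegative solution comes from a vector of positive height, which
    scales to a point of [P]. *)
Lemma facet_slack_model k (v : 'I_k -> 'rV[R]_n) d :
  has_dim (convex_hull (range v)) d.+1 ->
  fnum d (convex_hull (range v)) = d.+3 ->
  exists (c : 'I_d.+3 -> 'cV[R]_(n + 1)) (w : 'I_d.+3 -> R),
    slack_model (convex_hull (range v)) c w /\
    exists i j, 0 < w i /\ w j < 0.
Proof.
set P := convex_hull _ => dP /(facet_description dP)[c [c0 cnz cP]].
have rX : \rank (hommx v) = d.+2 := has_dim_rank dP.
have affP y : affine_hull P y <-> (row_mx y 1%:M <= hommx v)%MS.
  by rewrite affine_hull_convex affine_hull_hommx.
have cP' y : affine_hull P y -> (forall i, 0 <= ev (c i) y) -> P y.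
  by rewrite affine_hull_convex; exact: cP.
pose L : 'M[R]_(n + 1, d.+3) := \matrix_(i, j) c j i 0.
have LE (z : 'rV_(n + 1)) i : (z *m L) 0 i = (z *m c i) 0 0.
  by rewrite !mxE; apply: eq_bigr => j _; rewrite !mxE.
have LEv x i : (row_mx x 1%:M *m L) 0 i = ev (c i) x by rewrite LE.
have [p0 Pp0] := has_dim_neq0 dP.
have ray u : (row_mx u (0 : 'rV_1) <= hommx v)%MS ->
    (forall i, 0 <= (row_mx u (0 : 'rV_1) *m L) 0 i) -> u = 0.
  move=> uX uL; apply: (hull_no_ray (v := v) (x := p0)) => t t0.
  have E : row_mx (p0 + t *: u) 1%:M = row_mx p0 1%:M + t *: row_mx u (0 : 'rV_1) :> 'rV_(n + 1).
    by rewrite scale_row_mx add_row_mx scaler0 addr0.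
  apply: cP' => [|i].
    by apply/affP; rewrite E addmx_sub ?scalemx_sub//; apply/affP/sub_affine_hull.
  rewrite -LEv E mulmxDl -scalemxAl mxE [X in _ + X]mxE LEv.
  by rewrite addr_ge0 ?c0// mulr_ge0.
(* the cone over P is pointed, and lies above the hyperplane at infinity *)
have cone (z : 'rV_(n + 1)) : (z <= hommx v)%MS -> (forall i, 0 <= (z *m L) 0 i) ->
    0 <= z 0 (rshift n 0) /\ (z 0 (rshift n 0) = 0 -> z = 0).
  move=> zX zL; pose t := z 0 (rshift n 0).
  have zE : z = row_mx (lsubmx z) t%:M.
    rewrite -{1}(hsubmxK z); congr row_mx; apply/rowP => j.
    by rewrite !mxE !ord1 eqxx mulr1n.
  split; last first.
    rewrite -/t => t0; move: zE; rewrite t0 raddf0 => zE.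
    have l0 : lsubmx z = 0 by apply: ray => [|i]; rewrite -zE.
    by rewrite zE l0 row_mx0.
  rewrite -/t leNgt; apply/negP => t0.
  (* For negative height [t], subtracting [t] times a point of [P] leaves a horizontal vector with
     nonnegative slacks, hence 0 by [ray]. Then no slack would be positive at any point of [P]. *)
  have zp p : P p -> z = t *: row_mx p 1%:M.
    move=> Pp; have E : z - t *: row_mx p 1%:M = row_mx (lsubmx z - t *: p) (0 : 'rV_1).
      by rewrite {1}zE scale_row_mx opp_row_mx add_row_mx scalemx1 subrr.
    have l0 : lsubmx z - t *: p = 0.
      apply: ray => [|i]; rewrite -E.
        by rewrite addmx_sub// eqmx_opp scalemx_sub//; apply/affP/sub_affine_hull.
      rewrite mulmxBl -scalemxAl mxE [X in _ + X]mxE [X in - X]mxE LEv.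
      by rewrite addr_ge0// -mulNr mulr_ge0 ?c0// oppr_ge0 ltW.
    by apply/eqP; rewrite -subr_eq0 E l0 row_mx0.
  have [p Pp] := cnz ord0; case/negP; rewrite eq_le c0// andbT.
  by have := zL ord0; rewrite (zp _ Pp) -scalemxAl mxE LEv nmulr_rge0.
have coneI (z : 'rV_(n + 1)) : (z <= hommx v)%MS -> z *m L = 0 -> z = 0.
  move=> zX z0; have [|t0 h] := cone z zX; first by move=> i; rewrite z0 mxE.
  apply: h; apply/eqP; rewrite eq_le t0 andbT.
  have NzX : (- z <= hommx v)%MS by rewrite eqmx_opp.
  have [|h' _] := cone _ NzX; first by move=> i; rewrite mulNmx z0 oppr0 mxE.
  by move: h'; rewrite mxE oppr_ge0.
pose S := hommx v *m L.
have rS : \rank S = d.+2.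
  rewrite -[RHS]rX; apply/mxrank_injP/rowV0P => z; rewrite sub_capmx => /andP[zX zL].
  by apply: coneI => //; apply/sub_kermxP.
have [g gS g0] : exists2 g : 'cV[R]_d.+3, S *m g = 0 & g != 0.
  have : cokermx S != 0 by rewrite -mxrank_eq0 mxrank_coker rS subSn// subnn.
  move=> /matrix0Pn[i [j nz]]; exists (col j (cokermx S)).
    by rewrite colE mulmxA mulmx_coker mul0mx.
  by apply/matrix0Pn; exists i, 0; rewrite mxE.
have SE (s : 'rV_d.+3) : (s <= S)%MS = (s *m g == 0).
  have kS : (S <= kermx g)%MS by apply/sub_kermxP.
  have rg : \rank (kermx g) = d.+2.
    rewrite mxrank_ker; suff -> : \rank g = 1%N by rewrite subn1.
    by rewrite -mxrank_tr rank_rV -trmx0 (inj_eq trmx_inj) g0.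
  have /eqmxP e : (S == kermx g)%MS.
    by rewrite -(geq_leqif (mxrank_leqif_eq kS)) rg rS.
  by rewrite e; apply/sub_kermxP/eqP.
have sumE (s : 'rV_d.+3) : (s *m g) 0 0 = \sum_i g i 0 * s 0 i.
  by rewrite mxE; apply: eq_bigr => i _; rewrite mulrC.
have slackS x : P x -> (row_mx x 1%:M *m L <= S)%MS.
  by move=> Px; rewrite submxMr//; apply/affP/sub_affine_hull.
have slack0 x : P x -> \sum_i g i 0 * ev (c i) x = 0.
  move=> /slackS; rewrite SE => /eqP e.
  by under eq_bigr do rewrite -LEv; rewrite -sumE e mxE.
exists c, (fun i => g i 0); split; last first.
  have /choice[p pE] : forall i, exists x, P x /\ ev (c i) x != 0.
    by move=> i; have [x] := cnz i; exists x.
  (* A strictly positive solution; its existence forces the nonzero [g] to have both signs. *)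
  pose s j := \sum_i ev (c j) (p i).
  have cp i j : 0 <= ev (c j) (p i) by apply: c0; have [] := pE i.
  have s0 j : 0 < s j.
    rewrite /s (bigD1 j)//= ltr_pwDl//; last exact: sumr_ge0.
    by rewrite lt_def cp andbT; have [] := pE j.
  have gs : \sum_i g i 0 * s i = 0.
    under eq_bigr do rewrite mulr_sumr; rewrite exchange_big/=.
    by apply: big1 => i _; apply: slack0; have [] := pE i.
  have pos (h : 'I_d.+3 -> R) : \sum_i h i * s i = 0 -> (exists i, h i != 0) -> exists i, 0 < h i.
    move=> hs [i hi]; apply: contrapT => npos.
    have h0 j : 0 <= - (h j * s j).
      rewrite oppr_ge0 pmulr_lle0// leNgt; apply/negP => hj; by apply: npos; exists j.
    have : \sum_i - (h i * s i) == 0 by rewrite sumrN hs oppr0.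
    rewrite psumr_eq0// => /allP/(_ i); rewrite mem_index_enum => /(_ isT)/=.
    by rewrite oppr_eq0 mulf_eq0 (negbTE hi) gt_eqF.
  have [i1 [j1 nz]] := matrix0Pn _ g0; rewrite ord1 in nz.
  have [i gi] := pos _ gs (ex_intro _ i1 nz).
  have [||j gj] := pos (fun i => - g i 0).
  - by under eq_bigr do rewrite mulNr; rewrite sumrN gs oppr0.
  - by exists i1; rewrite oppr_eq0.
  by exists i, j; rewrite -oppr_gt0.
split=> //.
- by move=> x Px; split=> [i|]; [exact: c0|exact: slack0].
- move=> x Px; apply: contrapT => h.
  have x0 : row_mx x 1%:M *m L = 0.
    apply/rowP => i; rewrite LEv mxE; apply/eqP; apply: contraT => nz.
    by case: h; exists i.
  have /eqP := coneI _ (proj1 (affP x) (sub_affine_hull Px)) x0.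
  rewrite -row_mx0 => /eqP/eq_row_mx[_ /matrixP/(_ 0 0)]/eqP.
  by rewrite !mxE oner_eq0.
- move=> s s0 ws [i0 si0].
  have : ((\row_i s i : 'rV_d.+3) <= S)%MS.
    rewrite SE; apply/eqP/rowP => j; rewrite !ord1 sumE mxE -[RHS]ws.
    by apply: eq_bigr => i _; rewrite mxE.
  case/submxP => D; rewrite /S mulmxA.
  move: (D *m hommx v) (submxMl D (hommx v)) => z zX sE.
  have zL i : (z *m L) 0 i = s i by rewrite -sE mxE.
  have [|t0 z0] := cone z zX; first by move=> i; rewrite zL.
  set t := z 0 (rshift n 0) in t0 z0.
  have {t0 z0} t0 : 0 < t.
    rewrite lt_def t0 andbT; apply: contraNneq si0 => /z0 e.
    by rewrite -zL e mul0mx mxE.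
  pose x := t^-1 *: lsubmx z.
  have xE : row_mx x 1%:M = t^-1 *: z.
    rewrite -[in RHS](hsubmxK z) scale_row_mx; congr row_mx; apply/rowP => j.
    by rewrite !mxE !ord1 eqxx mulr1n mulVf// gt_eqF.
  have xL i : ev (c i) x = t^-1 * s i by rewrite -LEv xE -scalemxAl mxE zL.
  exists x.
    apply: cP' => [|i]; first by apply/affP; rewrite xE scalemx_sub.
    by rewrite xL mulr_ge0// invr_ge0 ltW.
  by move=> i; rewrite xL mulf_eq0 invr_eq0 gt_eqF.
Qed.

End PolytopeSlack.

(** * Face numbers and the lower bound *)

Section FaceNumbers.
Variables (R : realType) (n : nat).
Implicit Types (P F : set 'rV[R]_n).

Lemma fnum_balanced (I : finType) (A B : {set I}) p q r d P Phi :
  [disjoint A & B]%B -> #|A| = p -> #|B| = q -> (0 < p)%N -> (0 < q)%N ->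
  (p + q + r = d + 2)%N -> #|I| = (d + 2)%N ->
  is_dpolytope d P -> face_iso P (balanced A B) Phi ->
  forall m, (fnum m P + 'C(q + r, m.+2) + 'C(p + r, m.+2) =
             'C(p + q + r, m.+2) + 'C(r.+1, m.+2))%N.
Proof.
move=> AB pA qB p0 q0 pqr cI dP iso m.
have [a aA] : exists a, a \in A by apply/card_gt0P; rewrite pA.
have [b bB] : exists b, b \in B by apply/card_gt0P; rewrite qB.
rewrite (fnum_face_iso dP iso (balanced_pred AB) (balanced_succ AB cI aA bB)).
have cU : #|A :|: B| = (p + q)%N.
  by rewrite cardsU finset.disjoint_setI0// cards0 subn0 pA qB.
have cAB : #|~: (A :|: B)| = r by have := cardsC (A :|: B); rewrite cU cI; lia.
have cA : #|~: A| = (q + r)%N by have := cardsC A; rewrite pA cI; lia.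
have cB : #|~: B| = (p + r)%N by have := cardsC B; rewrite qB cI; lia.
by have := card_balanced AB m; rewrite cA cB cAB cI pqr (binS r) => ->; rewrite addnA.
Qed.

Lemma lower_bound_facets d P :
  is_dpolytope d P -> (2 * d + 1 <= fnum 0 P)%N -> fnum d.-1 P = (d + 2)%N ->
  forall m, (1 <= m <= d.-1)%N -> lower_bound d m <= (fnum m P)%:Z.
Proof.
move=> [pP dP] f0 fd m; case: d => [|d] in dP f0 fd *; first by lia.
move=> m1; have [k [v PE]] := polytope_range pP; rewrite PE in pP dP f0 fd *.
have fd' : fnum d (convex_hull (range v)) = d.+3 by rewrite -[d]/(d.+1.-1) fd addn2.
have [c [w [model [i [j [wi wj]]]]]] := facet_slack_model dP fd'.
have iso := slack_face_iso model.
set A := finset _ in iso; set B := finset _ in iso.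
have AB : [disjoint A & B]%B.
  by apply/pred0P => l /=; rewrite !inE; apply/negP => /andP[/lt_trans h /h]; rewrite ltxx.
have A0 : (0 < #|A|)%N by apply/card_gt0P; exists i; rewrite inE.
have B0 : (0 < #|B|)%N by apply/card_gt0P; exists j; rewrite inE.
have ABd : (#|A| + #|B| + (d.+3 - #|A| - #|B|) = d.+1 + 2)%N.
  have := max_card (A :|: B); rewrite cardsU finset.disjoint_setI0// cards0 subn0 card_ord; lia.
have cI : #|'I_d.+3| = (d.+1 + 2)%N by rewrite card_ord addn2.
have cnt := fnum_balanced AB erefl erefl A0 B0 ABd cI (conj pP dP) iso.
apply: lower_bound_le A0 B0 _ ABd (cnt 0%N) f0 (cnt m); lia.
Qed.

End FaceNumbers.

(** * Polytopes with a single affine dependency *)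

Section Circuits.
Variables (R : realType) (n : nat).
Implicit Types (P F Q : set 'rV[R]_n) (x y : 'rV[R]_n).

(** Fredholm alternative: the values [s] lie in the column space of the homogenized points once all
    affine dependencies annihilate them. *)
Lemma ev_interpolation (I : finType) (u : I -> 'rV[R]_n) (s : I -> R) :
  (forall c : I -> R, \sum_i c i = 0 -> \sum_i c i *: u i = 0 -> \sum_i c i * s i = 0) ->
  exists a, forall i, ev a (u i) = s i.
Proof.
move=> h; pose X := hommx (fun i : 'I_#|I| => u (enum_val i)).
pose sv : 'rV[R]_#|I| := \row_i s (enum_val i).
have reE (V : zmodType) (f : I -> V) := sum_enum_val f.
suff /submxP[D sD] : (sv <= X^T)%MS.
  exists D^T => i; have /rowP/(_ (enum_rank i)) := sD.
  rewrite mxE enum_rankK => ->; rewrite -[in RHS](trmxK D) -trmx_mul [RHS]mxE.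
  have -> : (X *m D^T) (enum_rank i) 0 = (row (enum_rank i) X *m D^T) 0 0.
    by rewrite -row_mul [RHS]mxE.
  by rewrite row_hommx /= enum_rankK.
rewrite submxE; apply/eqP/rowP => j; rewrite mxE [RHS]mxE.
pose cv := (col j (cokermx X^T))^T.
have : cv *m X = 0.
  apply: trmx_inj; rewrite trmx_mul trmxK trmx0 colE mulmxA mulmx_coker.
  by rewrite mul0mx.
have -> : (0 : 'rV[R]_(n + 1)) = row_mx 0 0%:M by rewrite raddf0 row_mx0.
rewrite mul_hommx => /row_mx1_inj[e1 e2].
have /h : \sum_i cv 0 (enum_rank i) = 0.
  by rewrite -reE -[RHS]e2; apply: eq_bigr => i _; rewrite enum_valK.
rewrite -!reE => hs; rewrite -[RHS]hs; first by apply: eq_bigr => i _; rewrite enum_valK !mxE mulrC.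
by rewrite -[RHS]e1; apply: eq_bigr => i _; rewrite enum_valK.
Qed.

(** [w] spans the affine dependencies. Unlike for a circuit of a matroid, it may vanish at some
    points, as it does at the apexes of pyramids. *)
Definition circuit (I : finType) (u : I -> 'rV[R]_n) (w : I -> R) :=
  [/\ \sum_i w i = 0, \sum_i w i *: u i = 0
    & forall c : I -> R, \sum_i c i = 0 -> \sum_i c i *: u i = 0 ->
        exists t, forall i, c i = t * w i].

(** The support of the values at the generators of any functional exposing [F]; taking the
    complement is what reverses inclusion. *)
Definition outside (I : finType) (u : I -> 'rV[R]_n) F : {set I} :=
  [set i | ~~ `[< F (u i) >]]%SET.

Lemma outsideP (I : finType) (u : I -> 'rV[R]_n) F i :
  i \in outside u F <-> ~ F (u i).
Proof. by rewrite inE; split=> [/negP h Fi|nF]; [apply/h/asboolP|apply/negP => /asboolP]. Qed.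

Lemma ev_dependency (I : finType) (u : I -> 'rV[R]_n) (c : I -> R) a :
  \sum_i c i = 0 -> \sum_i c i *: u i = 0 -> \sum_i c i * ev a (u i) = 0.
Proof.
move=> c0 cu; under eq_bigr do rewrite evE mulrDr.
rewrite big_split/= -mulr_suml c0 mul0r addr0.
transitivity (linval (usubmx a) (\sum_i c i *: u i)); last first.
  by rewrite cu /linval mul0mx mxE.
rewrite /linval mulmx_suml summxE; apply: eq_bigr => i _.
by rewrite -scalemxAl [RHS]mxE.
Qed.

Lemma exposed_vertex (I : finType) (u : I -> 'rV[R]_n) a F i :
  exposes a (convex_hull (range u)) F -> F (u i) <-> ev a (u i) = 0.
Proof.
by move=> [_ ->]; split=> [[]//|h]; split=> //; apply: sub_convex_hull; exists i.
Qed.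

Lemma face_vertexS (I : finType) (u : I -> 'rV[R]_n) F F' :
  is_face (convex_hull (range u)) F -> is_face (convex_hull (range u)) F' ->
  (F `<=` F' <-> forall i, F (u i) -> F' (u i)).
Proof.
move=> /is_faceP[a aF] /is_faceP[a' aF']; split=> [FF' i /FF'//|h].
rewrite (exposed_hull aF) (exposed_hull aF') => y [k [w [p [pu w0 w1 ->]]]].
exists k, w, p; split=> // i; have [j /= /(exposed_vertex _ aF) /h /(exposed_vertex _ aF') z <-] := pu i.
by exists j.
Qed.

Lemma face_of_values (I : finType) (u : I -> 'rV[R]_n) (s : I -> R) a :
  (forall i, 0 <= s i) -> (forall i, ev a (u i) = s i) ->
  exists2 F, exposes a (convex_hull (range u)) F & forall i, F (u i) <-> s i = 0.
Proof.
move=> s0 as_; exists (convex_hull (range u) `&` [set x | ev a x = 0]).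
  by split=> // x; apply: ev_hull => _ [i _ <-]; rewrite as_.
move=> i; rewrite -as_; split=> [[]//|e]; split=> //.
by apply: sub_convex_hull; exists i.
Qed.

(** By [ev_dependency] and [ev_interpolation], affine functionals take at the generators exactly the
    values solving the equation [w]; faces correspond to the supports of the nonnegative ones. *)
Lemma circuit_faces (I : finType) (u : I -> 'rV[R]_n) (w : I -> R) :
  let bal := balanced [set i | 0 < w i]%SET [set i | w i < 0]%SET in
  let Q := convex_hull (range u) in
  circuit u w ->
  [/\ forall F, is_face Q F -> bal (outside u F),
      forall F F', is_face Q F -> is_face Q F' ->
        (F `<=` F' <-> outside u F' \subset outside u F)
    & forall S, bal S -> exists2 F, is_face Q F & outside u F = S].
Proof.
move=> bal Q [w0 wu wc]; split.
- move=> F /is_faceP[a aF]; apply/balanced_supp; exists (ev a \o u); split=> /=.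
  + by move=> i; apply: aF.1; apply: sub_convex_hull; exists i.
  + exact: ev_dependency.
  + apply/setP => i; rewrite inE /=; apply/idP/idP => [/eqP h|/outsideP nF].
      by apply/outsideP => /(exposed_vertex i aF).
    by apply/eqP => /(exposed_vertex i aF).
- move=> F F' fF fF'; rewrite (face_vertexS fF fF'); split=> [h|/fintype.subsetP h i].
    by apply/fintype.subsetP => i /outsideP nF'; apply/outsideP => /h.
  by move=> Fi; apply: contrapT => /outsideP /h /outsideP; apply.
- move=> S /balanced_supp[s [s0 ws <-]].
  have [a as_] : exists a, forall i, ev a (u i) = s i.
    apply: ev_interpolation => c c0 cu; have [t ct] := wc c c0 cu.
    under eq_bigr do rewrite ct -mulrA.
    by rewrite -mulr_sumr ws mulr0.
  have [F aF Fs] := face_of_values s0 as_; exists F; first by apply/is_faceP; exists a.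
  apply/setP => i; rewrite [RHS]inE; apply/idP/idP => [/outsideP nF|/eqP si].
    by apply/eqP => /Fs.
  by apply/outsideP => /Fs.
Qed.

Lemma convex_hull_sub (I : finType) (u : I -> 'rV[R]_n) F :
  F `<=` convex_hull (range u) -> convex_hull F `<=` convex_hull (range u).
Proof.
move=> FQ y [k [w [p [pF w0 w1 ->]]]].
apply: (@convex_hull_rangeS _ _ _ _ p) => [i|]; first exact/FQ/pF.
by apply/convex_hull_range; exists w.
Qed.

Lemma convex_hullS F Q : F `<=` Q -> convex_hull F `<=` convex_hull Q.
Proof. by move=> FQ y [k [w [p [pF w0 w1 ->]]]]; exists k, w, p; split=> // i; exact: FQ. Qed.

Lemma convex_hull_add (I : finType) (u : I -> 'rV[R]_n) x :
  convex_hull (convex_hull (range u) `|` [set x]) = convex_hull (range (oapp u x)).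
Proof.
apply/seteqP; split.
  apply: convex_hull_sub => y [|->]; last by apply: sub_convex_hull; exists None.
  by apply: convex_hullS => _ [i _ <-]; exists (Some i).
apply: convex_hullS => _ [[i|] _ <-]; last by right.
by left; apply: sub_convex_hull; exists i.
Qed.

Lemma big_option (V : nmodType) (I : finType) (f : option I -> V) :
  \sum_o f o = f None + \sum_i f (Some i).
Proof.
rewrite (bigD1 None)//=; congr (_ + _).
rewrite (reindex_omap Some id)/=; last by case.
by apply: eq_bigl => i; rewrite eqxx.
Qed.

Lemma card_option_set (I : finType) (p : pred (option I)) :
  #|[set o | p o]%SET| = (p None + #|[set i | p (Some i)]%SET|)%N.
Proof.
have E (T : finType) (q : pred T) : #|[set x | q x]%SET| = \sum_x (q x : nat).
  by rewrite -sum1_card big_mkcond; apply: eq_bigr => x _; rewrite inE; case: (q x).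
by rewrite !E big_option.
Qed.

(** A dependency with nonzero coefficient at the apex could be solved for it, placing the apex in
    the affine hull of the base. *)
Lemma circuit_pyramid (I : finType) (u : I -> 'rV[R]_n) (w : I -> R) x :
  circuit u w -> ~ affine_hull (range u) x -> circuit (oapp u x) (oapp w 0).
Proof.
move=> [w0 wu wc] nx; split.
- by rewrite big_option/= add0r.
- by rewrite big_option/= scale0r add0r.
move=> c; rewrite !big_option/= => c0 cu.
have cN : c None = 0.
  apply/eqP; apply: contraT => cN; case: nx; apply/affine_hull_range.
  exists (fun i => - (c None)^-1 * c (Some i)); split.
    rewrite -mulr_sumr; move/eqP: c0; rewrite addrC addr_eq0 => /eqP ->.
    by rewrite mulrNN mulVf.
  under eq_bigr do rewrite -scalerA; rewrite -scaler_sumr.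
  move/eqP: cu; rewrite addrC addr_eq0 => /eqP ->.
  by rewrite scaleNr scalerN opprK scalerA mulVf// scale1r.
move: c0 cu; rewrite cN scale0r !add0r => c0 cu.
have [t ct] := wc (c \o Some) c0 cu.
by exists t => -[i|] /=; rewrite ?mulr0//; exact: ct.
Qed.

End Circuits.

(** * Simplices with an added point, and pyramids over them *)

Section Simplices.
Variables (R : realType) (n : nat).
Implicit Types (P F S : set 'rV[R]_n) (x y : 'rV[R]_n).

Lemma indep_interpolation k (v : 'I_k -> 'rV[R]_n) (s : 'I_k -> R) :
  affinely_independent v -> exists a, forall i, ev a (v i) = s i.
Proof.
move=> vi; apply: ev_interpolation => c c0 cv; apply: big1 => i _.
by rewrite (vi c c0 cv) mul0r.
Qed.

Lemma indep_has_dim k (v : 'I_k.+1 -> 'rV[R]_n) :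
  affinely_independent v -> has_dim (convex_hull (range v)) k.
Proof.
move=> vi; suff /eqP e : row_free (hommx v) by have := has_dim_hull v; rewrite e.
apply: inj_row_free => z; rewrite mul_hommx.
have -> : (0 : 'rV[R]_(n + 1)) = row_mx 0 0%:M by rewrite raddf0 row_mx0.
move=> /row_mx1_inj[e1 e2]; apply/rowP => i; rewrite mxE.
exact: (vi (fun i => z 0 i)).
Qed.

(** Any 0-1 values at the vertices extend to a functional, so the face lattice is Boolean and
    [face_rank_iso] identifies rank with cardinality. [F j] is the facet that misses [v j] only. *)
Lemma simplex_facets k (v : 'I_k.+2 -> 'rV[R]_n) :
  let S := convex_hull (range v) in
  affinely_independent v ->
  exists F : 'I_k.+2 -> set 'rV[R]_n,
    [/\ forall j, facets k.+1 S (F j),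
        forall G, facets k.+1 S G -> exists j, G = F j,
        injective F
      & forall j c, exposes c S (F j) ->
          (forall i, i != j -> ev c (v i) = 0) /\ 0 < ev c (v j)].
Proof.
move=> S vi.
have valF (J : {set 'I_k.+2}) : exists2 F, is_face S F & forall i, F (v i) <-> i \in J.
  have [a ha] := indep_interpolation (fun i => (i \notin J)%:R) vi.
  have [F aF Fv] := face_of_values (fun i => ler0n R (i \notin J)) ha.
  exists F; first by apply/is_faceP; exists a.
  move=> i; rewrite Fv; case: (i \in J); split=> //= /eqP.
  by rewrite oner_eq0.
pose Phi F : {set 'I_k.+2} := [set i | `[< F (v i) >]]%SET.
have PhiE F i : i \in Phi F <-> F (v i) by rewrite inE; split=> /asboolP.
have iso : face_iso S xpredT Phi.
  split=> // [F F' fF fF'|J _].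
    rewrite (face_vertexS fF fF'); split=> [h|/fintype.subsetP h i].
      by apply/fintype.subsetP => i /PhiE/h/PhiE.
    by move=> /PhiE/h/PhiE.
  have [F fF FJ] := valF J; exists F => //; apply/setP => i.
  by apply/idP/idP => [/PhiE/FJ|/FJ/PhiE].
have dS : is_dpolytope k.+1 S by split; [exact: range_polytope|exact: indep_has_dim].
have rk := face_rank_iso (rho := fun J => #|J|) dS iso.
have {}rk F l : is_face S F -> face_rank F l -> #|Phi F| = l.
  apply: rk => [J _ /card_gt0P[i iJ]|J _ Jk].
    exists (J :\ i)%SET => //; rewrite properD1//=.
    by rewrite (cardsD1 i J) iJ.
  have [i iJ] : exists i, i \notin J.
    apply/existsP; rewrite -negb_forall; apply: contraTN Jk => /forallP h.
    have -> : J = [set: _]%SET by apply/setP => i; rewrite h inE.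
    by rewrite cardsT card_ord ltnn.
  exists (i |: J)%SET => //; rewrite cardsU1 iJ eqxx andbT properE finset.subsetUr/=.
  by apply/subsetPn; exists i; rewrite // !inE eqxx.
have /choice[F FE] : forall j, exists F, is_face S F /\ forall i, F (v i) <-> i != j.
  move=> j; have [F fF Fv] := valF [set~ j]%SET; exists F; split=> // i.
  by rewrite Fv !inE.
have PhiF j : Phi (F j) = [set~ j]%SET.
  by apply/setP => i; rewrite [RHS]inE inE; apply/idP/idP => [/PhiE/(FE j).2|/(FE j).2/PhiE].
exists F; split.
- move=> j; have fF := (FE j).1; split=> //.
  have [l Fl] := face_rank_ex dS.1 fF.
  by have := rk _ _ fF Fl; rewrite PhiF cardsC1 card_ord => le; rewrite -le in Fl.
- move=> G [fG dG]; have := rk _ k.+1 fG dG => cG.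
  have : #|~: Phi G| == 1%N by have := cardsC (Phi G); rewrite cG card_ord; lia.
  move=> /cards1P[j Gj]; exists j; apply: (face_iso_inj iso fG (FE j).1).
  by rewrite PhiF -Gj finset.setCK.
- move=> j j' e; have : Phi (F j) = Phi (F j') by rewrite e.
  by rewrite !PhiF => /setP/(_ j); rewrite !inE eqxx => /esym/negbFE/eqP.
- move=> j c cF; split=> [i ij|].
    by apply/(exposed_vertex i cF)/(FE j).2.
  rewrite lt_def cF.1 ?andbT; last by apply: sub_convex_hull; exists j.
  by apply/eqP => /(exposed_vertex j cF)/(FE j).2; rewrite eqxx.
Qed.

(** A functional exposing the facet opposite [v j] takes at [x] the value [b j] times a positive
    number, so signs of barycentric coordinates decide between beyond and beneath. *)
Lemma simplex_beyond k (v : 'I_k.+2 -> 'rV[R]_n) (b : 'I_k.+2 -> R) :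
  let S := convex_hull (range v) in let x := \sum_i b i *: v i in
  affinely_independent v -> \sum_i b i = 1 ->
  ([set F | facets k.+1 S F /\ beyond S F x] #= `I_#|[set j | (b j < 0)%R]%SET|)%card /\
  ((forall F, facets k.+1 S F -> ~ beyond S F x -> beneath S F x) <->
   forall j, b j != 0).
Proof.
move=> S x vi b1; have [F [F1 F2 F3 F4]] := simplex_facets vi.
have cx j c : exposes c S (F j) -> ev c x = b j * ev c (v j).
  move=> /F4[c0 _]; rewrite ev_sum// (bigD1 j)//= big1 ?addr0// => i ij.
  by rewrite c0 ?mulr0.
have bey j : beyond S (F j) x <-> b j < 0.
  rewrite beyondP; split=> [[c cF]|bj].
    by rewrite (cx j)// pmulr_llt0//; have [] := F4 _ _ cF.
  have [/is_faceP[c cF] _] := F1 j; exists c => //.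
  by rewrite (cx j)// pmulr_llt0//; have [] := F4 _ _ cF.
have ben j : beneath S (F j) x <-> 0 < b j.
  rewrite beneathP; split=> [[c cF]|bj].
    by rewrite (cx j)// pmulr_lgt0//; have [] := F4 _ _ cF.
  have [/is_faceP[c cF] _] := F1 j; exists c => //.
  by rewrite (cx j)// pmulr_lgt0//; have [] := F4 _ _ cF.
split.
  have -> : [set G | facets k.+1 S G /\ beyond S G x] = F @` [set` [set j | b j < 0]%SET].
    apply/seteqP; split=> [G [fG bG]|_ [j bj <-]].
      have [j Gj] := F2 _ fG; exists j => //=; rewrite inE; apply/bey.
      by rewrite -Gj.
    by split; [exact: F1|apply/bey; move: bj; rewrite /= inE].
  apply: card_eq_trans (inj_card_eq _) _; first by move=> j j' _ _ /F3.
  by apply: (card_eq_image_set (f := id)) => //; rewrite image_id.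
split=> [h j|h G fG].
  have := h _ (F1 j); rewrite bey ben; case: (ltgtP (b j) 0) => // _.
  by move=> /(_ (fun e => notF e)).
have [j ->] := F2 _ fG; rewrite bey ben => /negP; rewrite -leNgt le_eqVlt eq_sym.
by rewrite (negbTE (h j)).
Qed.

Lemma simplex_circuit k (v : 'I_k -> 'rV[R]_n) (b : 'I_k -> R) :
  affinely_independent v -> \sum_i b i = 1 ->
  circuit (oapp v (\sum_i b i *: v i)) (oapp b (-1)).
Proof.
move=> vi b1; split.
- by rewrite big_option/= b1 addNr.
- by rewrite big_option/= scaleN1r addNr.
move=> c; rewrite !big_option/= => c0 cv; exists (- c None).
have h := vi (fun i => c None * b i + c (Some i)).
case=> [i|] /=; last by rewrite mulrN1 opprK.
apply/eqP; rewrite -subr_eq0 mulNr opprK addrC; apply/eqP/h.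
  by rewrite big_split/= -mulr_sumr b1 mulr1.
under eq_bigr do rewrite scalerDl -scalerA.
by rewrite big_split/= -scaler_sumr.
Qed.

(** The [m] facets that [x] lies beyond give [m] negative barycentric coordinates, the others are
    positive, and [x] itself has coefficient -1. *)
Lemma is_T_circuit i m P : is_T i m P ->
  exists (I : finType) (u : I -> 'rV[R]_n) (w : I -> R),
    [/\ circuit u w, P = convex_hull (range u), #|I| = i.+2,
        #|[set j | w j < 0]%SET| = m.+1 & #|[set j | 0 < w j]%SET| = (i.+1 - m)%N].
Proof.
case=> /andP[m1 mi] [S [x [[v vi SE] Sx cX ben PE]]].
case: i => [|k] in mi v vi SE cX ben *; first by move: mi; rewrite leqNgt m1.
rewrite SE affine_hull_convex in Sx.
have /affine_hull_range[b [b1 xE]] := Sx.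
have := simplex_beyond vi b1; rewrite -SE -xE => -[card1 /proj1/(_ ben) b0].
have negm : #|[set j | b j < 0]%SET| = m.
  have := card_eq_trans (_ : (`I_m #= _)%card) card1; rewrite card_eq_sym => /(_ cX).
  by move=> /card_eq_II ->.
have posm : #|[set j | 0 < b j]%SET| = (k.+2 - m)%N.
  have -> : [set j | 0 < b j]%SET = ~: [set j | b j < 0]%SET.
    by apply/setP => j; rewrite !inE -leNgt lt_def b0.
  by have := cardsC [set j | b j < 0]%SET; rewrite negm card_ord; lia.
exists (option 'I_k.+2), (oapp v x), (oapp b (-1)); split.
- by rewrite xE; exact: simplex_circuit.
- by rewrite PE SE convex_hull_add.
- by rewrite card_option card_ord.
- by rewrite card_option_set/= ltrN10 negm.
- by rewrite card_option_set/= ltr0N1 posm.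
Qed.

Lemma is_Tpyr_circuit d r m P : (r <= d)%N -> is_Tpyr d r m P ->
  exists (I : finType) (u : I -> 'rV[R]_n) (w : I -> R),
    [/\ circuit u w, P = convex_hull (range u), #|I| = d.+2,
        #|[set j | w j < 0]%SET| = m.+1 & #|[set j | 0 < w j]%SET| = ((d - r).+1 - m)%N].
Proof.
move=> rd [T /is_T_circuit]; have : (d = r + (d - r))%N by lia.
move: (d - r)%N => i -> {d rd}; elim: r P => [|r IHr] P /= hT; first by move=> ->.
move=> [P' /(IHr _ hT)[I [u [w [cuw P'E cI neg pos]]]] [x nx PE]].
exists (option I), (oapp u x), (oapp w 0); split.
- by apply: circuit_pyramid cuw _; rewrite -affine_hull_convex -P'E.
- by rewrite PE P'E convex_hull_add.
- by rewrite card_option cI.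
- by rewrite card_option_set/= ltxx neg.
- by rewrite card_option_set/= ltxx pos.
Qed.

End Simplices.

(** * Realizations and duality *)

Section Slices.
Variables (R : realType).

(* Mass is transported from the positive to the negative part of the equation w. *)
Lemma slice_generators (I : finType) (w : I -> R) :
  exists (K : {set I * I}) (g : I * I -> I -> R),
    [/\ forall p, p \in K -> [/\ forall i, 0 <= g p i, \sum_i w i * g p i = 0
          & \sum_i g p i = 1]
      & forall s : I -> R, (forall i, 0 <= s i) -> \sum_i w i * s i = 0 ->
          exists a : I * I -> R, [/\ forall p, 0 <= a p,
            forall p, p \notin K -> a p = 0
            & forall i, s i = \sum_p a p * g p i]].
Proof.
(* The rays of the solution cone: one for each pair of a positive and a negative index, and a unit
   vector for each index of weight zero, encoded as a diagonal pair. [g] scales them to sum 1. *)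
pose K := [set p : I * I | (0 < w p.1) && (w p.2 < 0) || (w p.1 == 0) && (p.1 == p.2)]%SET.
pose D (p : I * I) i : R := (p.1 == i)%:R.
pose E (p : I * I) i : R := (p.2 == i)%:R.
pose g (p : I * I) i : R := if w p.1 == 0 then D p i
  else (- w p.2 * D p i + w p.1 * E p i) / (w p.1 - w p.2).
have sD (f : I -> R) p : \sum_i f i * D p i = f p.1.
  rewrite (bigD1 p.1)//= /D eqxx mulr1 big1 ?addr0// => i ip.
  by rewrite eq_sym (negbTE ip) mulr0.
have sE (f : I -> R) p : \sum_i f i * E p i = f p.2.
  rewrite (bigD1 p.2)//= /E eqxx mulr1 big1 ?addr0// => i ip.
  by rewrite eq_sym (negbTE ip) mulr0.
have sg (f : I -> R) p : \sum_i f i * g p i = if w p.1 == 0 then f p.1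
    else (- w p.2 * f p.1 + w p.1 * f p.2) / (w p.1 - w p.2).
  rewrite /g; case: ifP => _; first exact: sD.
  rewrite -(sD f p) -(sE f p) !mulr_sumr -big_split/= mulr_suml.
  by apply: eq_bigr => i _; ring.
exists K, g; split=> [p|s s0 ws].
  rewrite inE => /orP[/andP[p1 p2]|/andP[/eqP p1 _]]; last first.
    split=> [i||]; first by rewrite /g p1 eqxx /D ler0n.
      by rewrite sg p1 eqxx.
    under eq_bigr do rewrite -[g p _]mul1r.
    by rewrite sg p1 eqxx.
  have n1 : w p.1 == 0 = false by rewrite gt_eqF.
  have pos : 0 < w p.1 - w p.2 by rewrite subr_gt0 (lt_trans p2).
  split=> [i||].
  - rewrite /g n1 divr_ge0 ?(ltW pos)// addr_ge0// mulr_ge0 ?ler0n ?(ltW p1)//.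
    by rewrite oppr_ge0 ltW.
  - by rewrite sg n1; apply/eqP; rewrite mulf_eq0; apply/orP; left; apply/eqP; ring.
  - under eq_bigr do rewrite -[g p _]mul1r.
    by rewrite sg n1 !mulr1 addrC divff// gt_eqF.
pose M := \sum_(i | 0 < w i) w i * s i.
have MN : \sum_(j | w j < 0) - w j * s j = M.
  have : \sum_i w i * s i = M - \sum_(j | w j < 0) - w j * s j.
    rewrite (bigID (fun i => 0 < w i))/=; congr (_ + _).
    rewrite (bigID (fun i => w i < 0))/= [X in _ + X]big1 => [|i]; last first.
      by rewrite -!leNgt => /andP[a b]; rewrite (_ : w i = 0) ?mul0r//; apply/eqP; rewrite eq_le a b.
    rewrite addr0 -sumrN; apply: eq_big => [i|i _]; last by rewrite mulNr opprK.
    by case: ltgtP.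
  by rewrite ws => /eqP; rewrite eq_sym subr_eq0 => /eqP.
have M0 : 0 <= M by apply: sumr_ge0 => i wi; rewrite mulr_ge0 ?(ltW wi).
(* The product coupling of the two parts of [s]; the factor [w p.1 - w p.2] cancels the
   normalization of [g]. *)
pose a (p : I * I) : R := if (0 < w p.1) && (w p.2 < 0) then s p.1 * s p.2 * (w p.1 - w p.2) / M
  else if (w p.1 == 0) && (p.1 == p.2) then s p.1 else 0.
exists a; split=> [p|p|k].
- rewrite /a; case: ifPn => [/andP[p1 p2]|_]; last by case: ifP.
  by rewrite divr_ge0// !mulr_ge0// subr_ge0 (ltW (lt_trans p2 p1)).
- by rewrite /a inE negb_or => /andP[/negbTE -> /negbTE ->].
(* For M = 0 the quotient is 0 by convention, but then [s] vanishes wherever [w] does not. *)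
have Mk i : w i != 0 -> s i * (M / M) = s i.
  have [M00|M00] := eqVneq M 0; last by rewrite divff// mulr1.
  have z (P : pred I) (f : I -> R) : (forall j, P j -> 0 <= f j) -> \sum_(j | P j) f j = 0 ->
      P i -> f i = 0.
    move=> f0 /eqP; rewrite psumr_eq0// => /allP/(_ i); rewrite mem_index_enum => /(_ isT).
    by move=> /implyP h /h/eqP.
  move=> wi; rewrite M00 invr0 mulr0 mulr0; apply/esym/eqP.
  have : w i * s i == 0; last by rewrite mulf_eq0 (negbTE wi).
  move: wi; rewrite neq_lt => /orP[] wi; last first.
    by apply/eqP/(z (fun i => 0 < w i) _ _ M00 wi) => j wj; rewrite mulr_ge0 ?(ltW wj).
  rewrite -oppr_eq0 -mulNr; apply/eqP.
  apply: (z (fun i => w i < 0) (fun i => - w i * s i) _ _ wi); last by rewrite MN.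
  by move=> j wj; rewrite mulr_ge0// oppr_ge0 ltW.
have row i : \sum_j a (i, j) * g (i, j) k =
    (i == k)%:R * s i * (if 0 < w i then M / M else (w i == 0)%:R)
    + (if 0 < w i then w i * s i else 0) * (if w k < 0 then s k / M else 0).
  rewrite /a /g /D /E /=; case: (ltgtP (w i) 0) => [wi|wi|wi] /=.
  - by rewrite mul0r mulr0 addr0 big1// => j _; rewrite mul0r.
  - transitivity (\sum_(j | w j < 0) ((i == k)%:R * s i / M * (- w j * s j)
        + w i * s i / M * (s j * (j == k)%:R))).
      rewrite [RHS]big_mkcond/=; apply: eq_bigr => j _.
      case: ifPn => wj; last by rewrite mul0r.
      have dw : w i - w j != 0 by rewrite gt_eqF// subr_gt0 (lt_trans wj).
      transitivity (s i * s j / M * (- w j * (i == k)%:R + w i * (j == k)%:R) * ((w i - w j) / (w i - w j))).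
        by ring.
      by rewrite divff// mulr1; ring.
    rewrite big_split/= -!mulr_sumr MN; congr (_ + _); first by ring.
    rewrite -[LHS]mulrA; congr (_ * _).
    case: ifPn => wk.
      rewrite [LHS]mulrC (bigD1 k)//= eqxx mulr1 big1 ?addr0// => j /andP[_ /negbTE ->].
      by rewrite mulr0.
    rewrite big1 ?mulr0// => j wj; case: eqP => [jk|_]; last by rewrite mulr0.
    by rewrite -jk wj in wk.
  - rewrite mulr1 mul0r addr0 (bigD1 i)//= eqxx big1 ?addr0 1?mulrC// => j ji.
    by rewrite eq_sym (negbTE ji) mul0r.
rewrite (eq_bigr (fun p => a (p.1, p.2) * g (p.1, p.2) k)); last by case.
rewrite -(pair_bigA _ (fun i j => a (i, j) * g (i, j) k))/= (eq_bigr _ (fun i _ => row i)).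
rewrite big_split/= -mulr_suml -big_mkcond/= -/M (bigD1 k)//= eqxx mul1r big1 ?addr0; last first.
  by move=> i /negbTE ->; rewrite !mul0r.
case: (ltgtP (w k) 0) => wk.
- by rewrite mulr0 add0r mulrCA Mk// lt_eqF.
- by rewrite mulr0 addr0 Mk// gt_eqF.
- by rewrite mulr0 addr0 mulr1.
Qed.

(** An affine chart, with origin [t0], of the solutions of sum 1. Since [w] takes both signs it is
    not constant, so the two equations are independent and the chart has dimension d. *)
Lemma slice_coordinates (I : finType) (w t0 : I -> R) d i0 j0 :
  #|I| = (d + 2)%N -> 0 < w i0 -> w j0 < 0 ->
  \sum_i w i * t0 i = 0 -> \sum_i t0 i = 1 ->
  exists c : I -> 'cV[R]_(d + 1),
    [/\ forall i, ev (c i) 0 = t0 i,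
        forall y, \sum_i w i * ev (c i) y = 0 /\ \sum_i ev (c i) y = 1,
        forall y y', (forall i, ev (c i) y = ev (c i) y') -> y = y'
      & forall s : I -> R, \sum_i w i * s i = 0 -> \sum_i s i = 1 ->
          exists y, forall i, ev (c i) y = s i].
Proof.
move=> cI wi wj wt t1.
have ord2P (j : 'I_2) : j = 0 \/ j = 1.
  by case: j => -[|[|]]//= p; [left|right]; apply: val_inj.
have reE (f : I -> R) := sum_enum_val f.
pose B : 'M[R]_(#|I|, 2) := \matrix_(i, j) if j == 0 then w (enum_val i) else 1.
have BE (f : I -> R) : (\row_k f (enum_val k)) *m B = 0 <->
    \sum_i w i * f i = 0 /\ \sum_i f i = 1 * 0.
  have E0 : ((\row_k f (enum_val k)) *m B) 0 0 = \sum_i w i * f i.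
    by rewrite mxE -reE; apply: eq_bigr => k _; rewrite !mxE eqxx mulrC.
  have E1 : ((\row_k f (enum_val k)) *m B) 0 1 = \sum_i f i.
    by rewrite mxE -reE; apply: eq_bigr => k _; rewrite !mxE mulr1.
  rewrite mulr0; split=> [e|[e0 e1]]; first by rewrite -E0 -E1 e !mxE.
  apply/rowP => j; rewrite [RHS]mxE.
  have [->|->] := ord2P j; by rewrite ?E0 ?E1.
have rB : \rank B = 2%N.
  rewrite -mxrank_tr; apply/eqP; apply: inj_row_free => z zB.
  have zE i : z 0 0 * w i + z 0 1 = 0.
    have /rowP/(_ (enum_rank i)) := zB.
    rewrite !mxE !big_ord_recl big_ord0 !mxE/= enum_rankK addr0 mulr1 => <-.
    by congr (_ + z 0 _); apply: val_inj.
  have : z 0 0 * (w i0 - w j0) == 0.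
    by rewrite mulrBr -[X in X - _](addrK (z 0 1)) zE -[X in _ - X](addrK (z 0 1)) zE subrr.
  rewrite mulf_eq0 subr_eq0 (gt_eqF (lt_trans wj wi)) orbF => /eqP z0.
  have := zE i0; rewrite z0 mul0r add0r => z1.
  apply/rowP => j; rewrite [RHS]mxE.
  by have [->|->] := ord2P j.
have rK : \rank (kermx B) = d by rewrite mxrank_ker rB cI addnK.
have [M [Mfree MK]] : exists M : 'M[R]_(d, #|I|), row_free M /\ (M :=: kermx B)%MS.
  rewrite -rK; exists (row_base (kermx B)); split; [exact: row_base_free|exact: eq_row_base].
have MB : M *m B = 0 by apply/sub_kermxP; rewrite MK.
pose c i : 'cV[R]_(d + 1) := col_mx (col (enum_rank i) M) (const_mx (t0 i)).
have cE i y : ev (c i) y = (y *m M) 0 (enum_rank i) + t0 i.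
  rewrite /ev mul_row_col mul1mx mxE [const_mx _ _ _]mxE; congr (_ + _).
  by rewrite !mxE; apply: eq_bigr => k _; rewrite mxE.
have yB (y : 'rV[R]_d) : \sum_i w i * (y *m M) 0 (enum_rank i) = 0 /\
    \sum_i (y *m M) 0 (enum_rank i) = 1 * 0.
  apply/BE; rewrite -[RHS](mulmx0 _ y) -MB mulmxA; congr (_ *m _).
  by apply/rowP => k; rewrite mxE enum_valK.
exists c; split.
- by move=> i; rewrite cE mul0mx mxE add0r.
- move=> y; have [y0 y1] := yB y; split.
    under eq_bigr do rewrite cE mulrDr.
    by rewrite big_split/= y0 wt addr0.
  under eq_bigr do rewrite cE.
  by rewrite big_split/= y1 t1 mulr0 add0r.
- move=> y y' e; apply: (row_free_inj Mfree); apply/rowP => k.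
  by have := e (enum_val k); rewrite !cE enum_valK => /addIr.
- move=> s ws s1; have /sub_kermxP : (\row_k (s (enum_val k) - t0 (enum_val k))) *m B = 0.
    apply/(BE (fun i => s i - t0 i)); split.
      by under eq_bigr do rewrite mulrBr; rewrite sumrB ws wt subrr.
    by rewrite sumrB s1 t1 subrr mulr0.
  rewrite -MK => /submxP[y yE]; exists y => i.
  by rewrite cE -yE mxE enum_rankK subrK.
Qed.

(** The nonnegative solutions of sum 1 form a polytope by [slice_generators]. Centring the chart at
    a strictly positive solution makes the origin an interior point, hence full dimension. *)
Lemma slice_polytope (I : finType) (w : I -> R) d i0 j0 :
  #|I| = (d + 2)%N -> 0 < w i0 -> w j0 < 0 ->
  exists (P : set 'rV[R]_d) (c : I -> 'cV[R]_(d + 1)),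
    is_dpolytope d P /\ slack_model P c w.
Proof.
move=> cI wi wj.
have [t [t_ge0 wt suppt]] : exists t : I -> R,
    [/\ forall i, 0 <= t i, \sum_i w i * t i = 0 & supp t = [set: I]%SET].
  apply/balanced_supp; rewrite /balanced.
  rewrite (disjoint_sub0 (i := i0)) ?inE// (disjoint_sub0 (i := j0)) ?inE//.
have t_gt0 i : 0 < t i.
  by rewrite lt_def t_ge0 andbT; move/setP/(_ i): suppt; rewrite !inE.
have T0 : 0 < \sum_i t i by rewrite (bigD1 i0)//=; apply: ltr_pwDl => //; exact: sumr_ge0.
pose t0 i := t i / \sum_i t i.
have t0_gt0 i : 0 < t0 i by apply: divr_gt0.
have [||c [c0 cw cinj csurj]] := @slice_coordinates I w t0 d i0 j0 cI wi wj.
- by under eq_bigr do rewrite mulrA; rewrite -mulr_suml wt mul0r.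
- by rewrite -mulr_suml divff// gt_eqF.
pose P : set 'rV[R]_d := [set y | forall i, 0 <= ev (c i) y].
exists P, c; split; [split|].
- have [K [g [gK gs]]] := slice_generators w.
  (* The default value 0 is a point of [P], so the pairs outside [K] do not enlarge the hull. *)
  have /choice[v vE] : forall p, exists y, if p \in K then forall i, ev (c i) y = g p i else y = 0.
    move=> p; case: (boolP (p \in K)) => [/gK[_ gw g1]|_]; last by exists 0.
    by have [y yE] := csurj _ gw g1; exists y.
  have vP p : P (v p).
    move=> i; have := vE p; case: ifPn => [/gK[g0 _ _] ->//|_ ->].
    by rewrite c0 ltW.
  suff -> : P = convex_hull (range v) by exact: range_polytope.
  apply/seteqP; split=> y; last first.
    by move=> yv i; apply: (ev_hull (P := range v)) yv => _ [p _ <-]; exact: vP.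
  move=> Py; have [w0 s1] := cw y; have [a [a0 aK sa]] := gs _ Py w0.
  have a1 : \sum_p a p = 1.
    rewrite -s1; under [RHS]eq_bigr do rewrite sa.
    rewrite exchange_big/=; apply: eq_bigr => p _; rewrite -mulr_sumr.
    have [/gK[_ _ ->]|/aK ->] := boolP (p \in K); first by rewrite mulr1.
    by rewrite mul0r.
  apply/convex_hull_range; exists a; split=> //.
  apply: cinj => i; rewrite ev_sum// sa; apply: eq_bigr => p _.
  have := vE p; case: ifPn => [_ ->//|/aK ->]; by rewrite !mul0r.
- have P0 : P 0 by move=> i; rewrite c0 ltW.
  exists 0, fullv; split=> //; first by rewrite dimvf dim_matrix; exact: mul1n.
  apply/seteqP; split=> y //= _; first by rewrite memvf.
  (* [S] bounds the relative change of every slack from the origin to [y], so y / (1 + S) lies in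
     [P], and [y] lies on the line through it and the origin. *)
  pose S := \sum_i `|ev (c i) y - t0 i| / t0 i.
  have S0 : 0 <= S by apply: sumr_ge0 => i _; rewrite divr_ge0 ?(ltW (t0_gt0 i)).
  have S1 : 0 < 1 + S by rewrite ltr_pwDl.
  have Py : P ((1 + S)^-1 *: y).
    move=> i; have := ev_cvx (c i) 0 y (1 + S)^-1; rewrite subr0 add0r c0 => ->.
    have h : `|ev (c i) y - t0 i| <= S * t0 i.
      rewrite -ler_pdivrMr// /S (bigD1 i)//= lerDl.
      by apply: sumr_ge0 => j _; rewrite divr_ge0 ?(ltW (t0_gt0 j)).
    have -> : t0 i + (1 + S)^-1 * (ev (c i) y - t0 i) =
        (1 + S)^-1 * (t0 i + (S * t0 i + (ev (c i) y - t0 i))).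
      by field; rewrite gt_eqF.
    rewrite mulr_ge0 ?invr_ge0 ?(ltW S1)// addr_ge0 ?(ltW (t0_gt0 i))//.
    by rewrite -lerBlDl sub0r; move: h; rewrite ler_norml => /andP[].
  have := affine_hull_line (1 + S) (sub_affine_hull P0) (sub_affine_hull Py).
  by rewrite subr0 add0r scalerA divff ?scale1r// gt_eqF.
- split.
  + by move=> x Px; split=> //; have [] := cw x.
  + move=> x Px; apply: contrapT => h; have [_ /eqP] := cw x.
    rewrite big1 ?(eq_sym 0) ?oner_eq0// => i _; apply/eqP; apply: contraT => nz.
    by case: h; exists i.
  + move=> s s0 ws [i si]; have S0 : 0 < \sum_i s i.
      by rewrite (bigD1 i)//=; apply: ltr_pwDl; [rewrite lt_def si s0|exact: sumr_ge0].
    have [||x xE] := csurj (fun i => s i / \sum_i s i).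
    * by under eq_bigr do rewrite mulrA; rewrite -mulr_suml ws mul0r.
    * by rewrite -mulr_suml divff// gt_eqF.
    exists x => j; rewrite xE ?divr_ge0 ?(ltW S0)//.
    by rewrite mulf_eq0 invr_eq0 (gt_eqF S0) orbF.
  + by [].
Qed.

End Slices.

(** * Existence of the simplicial polytopes and their pyramids *)

Section Realizations.
Variables (R : realType) (d : nat).

(** The simplex is spanned by the origin and unit vectors; the coordinates from [i] on stay zero,
    which reserves them for the apexes. *)
Lemma is_T_exists i m : (i <= d)%N -> (1 <= m <= i./2)%N ->
  exists2 T : set 'rV[R]_d, is_T i m T &
    forall y, T y -> forall k : 'I_d, (i <= k)%N -> y 0 k = 0.
Proof.
case: i => [|i] id mi; first by move: mi; rewrite leqn0; case/andP => m1 /eqP m0; rewrite m0 in m1.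
have mlt : (m < i.+2)%N by have := odd_double_half i.+1; lia.
pose v (j : 'I_i.+2) : 'rV[R]_d := \row_(l < d) (l.+1 == j)%:R.
(* The added point has barycentric coordinate -1 at the first [m] vertices and [g] at the others;
   this value makes the sum 1. *)
pose g : R := (1 + m%:R) / (i.+2 - m)%:R.
pose b (j : 'I_i.+2) : R := g - (j < m)%N%:R * (g + 1).
have im0 : 0 < (i.+2 - m)%:R :> R by rewrite ltr0n subn_gt0.
have g0 : 0 < g by rewrite divr_gt0// ltr_pwDl.
have bneg j : (b j < 0) = (j < m)%N.
  by rewrite /b; case: ltnP => _; rewrite ?mul1r ?mul0r ?subr0 ?opprD ?addNKr ?ltrN10// ltNge ltW.
have cardm : (\sum_(j < i.+2) (j < m) = m)%N.
  rewrite -[RHS]card_ord -sum1_card (big_ord_widen _ (fun=> 1%N) (ltnW mlt)) [RHS]big_mkcond.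
  by apply: eq_bigr => j _; case: ltnP.
have b1 : \sum_j b j = 1.
  have -> : \sum_j b j = \sum_(j < i.+2) g - (\sum_(j < i.+2) (j < m)%N%:R) * (g + 1).
    by rewrite mulr_suml -sumrB.
  rewrite -natr_sum cardm sumr_const card_ord -(mulr_natl g).
  have -> : i.+2%:R = (i.+2 - m)%:R + m%:R :> R by rewrite -natrD subnK// ltnW.
  by rewrite /g; field; rewrite gt_eqF.
have vi : affinely_independent v.
  move=> w w1 wv; have wS (j : 'I_i.+2) : j != ord0 -> w j = 0.
    move=> j0; have jd : (j.-1 < d)%N by have := ltn_ord j; lia.
    have := congr1 (fun M : 'rV[R]_d => M 0 (Ordinal jd)) wv.
    rewrite summxE mxE (bigD1 j)//= !mxE /= prednK ?lt0n// eqxx mulr1 big1 ?addr0// => l lj.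
    by rewrite !mxE/= prednK ?lt0n// eq_sym (inj_eq val_inj) (negbTE lj) mulr0.
  move=> j; have [->|/wS//] := eqVneq j ord0.
  by move: w1; rewrite (bigD1 ord0)//= big1 ?addr0// => l /wS.
have [c1 c2] := simplex_beyond vi b1.
exists (convex_hull (convex_hull (range v) `|` [set \sum_i b i *: v i])).
  split=> //; exists (convex_hull (range v)), (\sum_i b i *: v i); split=> //.
  - by exists v.
  - by rewrite affine_hull_convex; apply/affine_hull_range; exists b.
  - suff <- : #|[set j | b j < 0]%SET| = m by [].
    rewrite -[RHS]cardm -sum1_card big_mkcond; apply: eq_bigr => j _.
    by rewrite inE bneg; case: ltnP.
  - apply/c2 => j; rewrite /b; case: ltnP => _; first by rewrite mul1r opprD addNKr oppr_eq0 oner_eq0.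
    by rewrite mul0r subr0 gt_eqF.
rewrite convex_hull_add => y /convex_hull_range[w [_ _ ->]] k ik.
have vk j : v j 0 k = 0.
  by rewrite mxE gtn_eqF// (leq_trans (ltn_ord j)).
rewrite summxE big1// => -[j|] _; rewrite mxE /= ?vk ?mulr0//.
by rewrite summxE big1 ?mulr0// => j _; rewrite mxE vk mulr0.
Qed.

Lemma iter_pyramid_exists i r (T : set 'rV[R]_d) : (i + r <= d)%N ->
  (forall y, T y -> forall k : 'I_d, (i <= k)%N -> y 0 k = 0) ->
  exists2 Q, is_iter_pyramid r T Q &
    forall y, Q y -> forall k : 'I_d, (i + r <= k)%N -> y 0 k = 0.
Proof.
move=> ird T0; elim: r ird => [|r IHr] ird.
  by exists T => // y Ty k; rewrite addn0; exact: T0.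
have [|Q TQ Q0] := IHr; first by lia.
have kd : (i + r < d)%N by lia.
pose e : 'rV[R]_d := delta_mx 0 (Ordinal kd).
exists (convex_hull (Q `|` [set e])).
  exists Q => //; exists e => // -[k [w [p [pQ _ eE]]]].
  have := congr1 (fun M : 'rV[R]_d => M 0 (Ordinal kd)) eE.
  rewrite !mxE !eqxx summxE big1 => [/eqP|j _]; first by rewrite oner_eq0.
  by rewrite mxE (Q0 _ (pQ j)) ?mulr0.
move=> y [k [w [p [pQ _ _ ->]]]] l irl; rewrite summxE big1// => j _; rewrite mxE.
case: (pQ j) => [/Q0 ->|->]; rewrite ?mulr0//; first by lia.
have le : l != Ordinal kd by rewrite -val_eqE/=; lia.
by rewrite mxE (negbTE le) andbF mulr0.
Qed.

Lemma is_Tpyr_exists r m : (r <= d)%N -> (1 <= m <= (d - r)./2)%N ->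
  exists Q : set 'rV[R]_d, is_Tpyr d r m Q.
Proof.
move=> rd mr; have [T isT T0] := is_T_exists (leq_subr r d) mr.
have [|Q TQ _] := @iter_pyramid_exists (d - r) r T _ T0; first by rewrite subnK.
by exists Q, T.
Qed.

End Realizations.

(** * Transfer between a polytope and its dual *)

Section Duality.
Variables (R : realType) (n n' : nat) (I : finType).
Variables (u : I -> 'rV[R]_n') (w : I -> R).
Hypothesis cuw : circuit u w.
Let bal := balanced [set i | 0 < w i]%SET [set i | w i < 0]%SET.

(** Duality reverses inclusion and [outside] reverses it back. *)
Lemma dual_face_iso (P : set 'rV[R]_n) : are_dual P (convex_hull (range u)) ->
  exists Phi, face_iso P bal Phi.
Proof.
have [q1 q2 q3] := circuit_faces cuw.
case=> phi [[pf pi ps] mono]; exists (outside u \o phi); split=> /=.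
- by move=> F fF; apply/q1/pf.
- by move=> F F' fF fF'; rewrite mono// q2//; exact: pf.
- move=> S /q3[G fG <-]; have [F fF FG] := ps _ fG; exists F => //=.
  by rewrite FG.
Qed.

Lemma face_iso_dual (P : set 'rV[R]_n) Phi :
  face_iso P bal Phi -> are_dual P (convex_hull (range u)).
Proof.
have [q1 q2 q3] := circuit_faces cuw.
move=> iso; have [p1 p2 p3] := iso.
have /choice[psi psiE] : forall S, exists G, bal S ->
    is_face (convex_hull (range u)) G /\ outside u G = S.
  move=> S; have [bS|nbS] := boolP (bal S); last by exists set0.
  by have [G fG GS] := q3 S bS; exists G.
have psiP F : is_face P F -> is_face (convex_hull (range u)) (psi (Phi F)) /\
    outside u (psi (Phi F)) = Phi F.
  by move=> fF; apply/psiE/p1.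
exists (psi \o Phi); split; last first.
  move=> F F' fF fF'; have [g1 e1] := psiP _ fF; have [g2 e2] := psiP _ fF'.
  by rewrite p2//= q2// e1 e2.
split.
- by move=> F /psiP[].
- move=> F F' /set_mem fF /set_mem fF' /= e; apply: (face_iso_inj iso fF fF').
  by rewrite -(psiP _ fF).2 e (psiP _ fF').2.
- move=> G fG; have [F fF FG] := p3 _ (q1 _ fG); exists F => //=.
  have [fF' e] := psiP _ fF; apply/seteqP; split; apply/q2 => //; rewrite e FG//.
Qed.

End Duality.

Theorem lemma4p3 (R : realType) :
  (forall (n d : nat) (P : set 'rV[R]_n),
     is_dpolytope d P ->
     (2 * d + 1 <= fnum 0 P)%N ->
     fnum d.-1 P = (d + 2)%N ->
     forall m : nat, (1 <= m <= d.-1)%N ->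
       lower_bound d m <= (fnum m P)%:Z)
  /\
  (forall d : nat, (4 <= d)%N -> ~~ odd d ->
     (exists P Q : set 'rV[R]_d,
        [/\ is_dpolytope d P, is_Tpyr d (d./2 - 2) 2 Q & are_dual P Q])
     /\
     (forall (n n' : nat) (P : set 'rV[R]_n) (Q : set 'rV[R]_n'),
        is_dpolytope d P -> is_Tpyr d (d./2 - 2) 2 Q -> are_dual P Q ->
        [/\ fnum 0 P = (2 * d + 1)%N,
            fnum d.-1 P = (d + 2)%N
          & forall m : nat, (1 <= m)%N ->
              (fnum m P)%:Z = lower_bound d m])).
Proof.
split; first exact: lower_bound_facets.
move=> d d4 d_even; have dE : d = (d./2).*2 by rewrite even_halfK.
have rd : (d./2 - 2 <= d)%N by lia.
have posE : ((d - (d./2 - 2)).+1 - 2 = d./2.+1)%N by lia.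
split.
  have [|Q TQ] := @is_Tpyr_exists R d (d./2 - 2) 2 rd; first by lia.
  have [I [u [w [cuw QE cI neg pos]]]] := is_Tpyr_circuit rd TQ.
  have [i wi] : exists i, i \in [set j | 0 < w j]%SET by apply/card_gt0P; rewrite pos posE.
  have [j wj] : exists i, i \in [set j | w j < 0]%SET by apply/card_gt0P; rewrite neg.
  rewrite !inE in wi wj.
  have [|P [c [dP model]]] := @slice_polytope R I w d i j _ wi wj; first by rewrite cI addn2.
  exists P, Q; split=> //; rewrite QE.
  exact: (face_iso_dual cuw (slack_face_iso model)).
move=> n n' P Q dP TQ dPQ.
have [I [u [w [cuw QE cI neg pos]]]] := is_Tpyr_circuit rd TQ.
rewrite QE in dPQ; have [Phi iso] := dual_face_iso cuw dPQ.
rewrite posE in pos.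
have AB : [disjoint [set j | (0 < w j)%R]%SET & [set j | (w j < 0)%R]%SET]%B.
  by apply/pred0P => l /=; rewrite !inE; apply/negP => /andP[/lt_trans h /h]; rewrite ltxx.
have pqr : (d./2.+1 + 3 + (d./2 - 2) = d + 2)%N by lia.
have cI' : #|I| = (d + 2)%N by rewrite cI addn2.
have cnt := fnum_balanced AB pos neg isT isT pqr cI' dP iso.
split.
(* The vertex count is 3 (d/2 + 1) + (d/2 - 2) = 2 d + 1. *)
- have -> := rect_count_vertices _ _ (cnt 0%N); lia.
(* For m = d - 1 only ['C(d + 2, d + 1)] survives; the upper indices of the other binomials are at
   most d. *)
- have := cnt d.-1; rewrite prednK; last by lia.
  have z k : (k <= d)%N -> 'C(k, d.+1) = 0%N by move=> kd; rewrite bin_small.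
  rewrite pqr addn2 binSn !z ?addn0; lia.
- move=> m m1; apply: lower_bound_eq => //.
  by have := cnt m; rewrite (addnC d./2.+1 3) => <-; rewrite addnAC.
Qed.
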